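(* Let $\bar M={}_fI\times_\sigma M$ be a doubly warped spacetime with metric $\bar g=-f^2dt^2\oplus\sigma^2g$ obeying Einstein's field equation, and let $\bar\zeta=h\partial_t+\zeta$ be a vector field on $\bar M$. Then: (1) $\bar M$ admits a time-like matter collineation $\bar\zeta=h\partial_t$ if $\dot h=\dot\sigma=0$; (2) $\bar M$ admits a space-like matter collineation $\bar\zeta=\zeta$ if $\zeta$ is a Killing vector field on $M$ and $\zeta(f)=0$; (3) $\bar M$ admits a matter collineation $\bar\zeta=h\partial_t+\zeta$ if $\dot h=-\zeta(\ln f)$ and $\zeta$ is a conformal vector field on $M$ with conformal factor $\rho_2=-\dfrac{2h\dot\sigma}{\sigma}$.
   Context: $(M,g)$ is a Riemannian manifold, $I$ is an open connected interval with metric $-dt^2$, and $f:M\to(0,\infty)$, $\sigma:I\to(0,\infty)$ are smooth. The doubly warped spacetime ${}_fI\times_\sigma M$ is $I\times M$ with the metric $\bar g=-f^2dt^2\oplus\sigma^2g$. Here $h:I\to\mathbb R$ is smooth, $\zeta\in\mathfrak X(M)$ (identified with its lift), and a dot denotes $d/dt$. A vector field $\zeta$ on $(N,k)$ is conformal with factor $\rho$ if $\mathcal L_\zeta k=\rho k$, and Killing if $\mathcal L_\zeta k=0$; in (3) the conformality condition means $\mathcal L_\zeta g=-\frac{2h(t)\dot\sigma(t)}{\sigma(t)}g$ for every $t\in I$, and $\dot h=-\zeta(\ln f)$ holds on $I\times M$. Einstein's field equation with cosmological constant $\lambda$ is $\overline{\mathrm{Ric}}-\frac r2\bar g=\kappa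 \mathrm T-\lambda\bar g$, where $r$ is the scalar curvature of $\bar g$, $\kappa\neq0$ is a constant and $\mathrm T$ is the energy-momentum tensor. A vector field $\bar\zeta$ is a matter collineation if $\mathcal L_{\bar\zeta}\mathrm T=0$. ''Time-like'' and ''space-like'' here just refer to the forms $h\partial_t$ and $\zeta$ respectively. *)

(* Defs.v *)
(* Smooth manifolds are given by an atlas; a tensor field is the family of its
   components in the charts, as functions of the coordinates, subject to the
   usual transformation law.  Points of R^n are row vectors. *)
From HB Require Import structures.
From mathcomp Require Import all_boot all_order all_algebra.
From mathcomp Require Import all_classical all_reals all_analysis.

Set Implicit Arguments.
Unset Strict Implicit.
Unset Printing Implicit Defensive.
Import Order.TTheory GRing.Theory Num.Theory numFieldNormedType.Exports.
Local Open Scope classical_set_scope.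
Local Open Scope ring_scope.

(* C^k on an open set U, phrased with directional derivatives; in finite
   dimension this is the existence and continuity on U of all the partial
   derivatives of order at most k. *)
Fixpoint class_C (R : realType) (V W : normedModType R) (k : nat) (U : set V)
    (F : V -> W) : Prop :=
  (forall x, U x -> {for x, continuous F}) /\
  (if k is k'.+1 then
     forall v, (forall x, U x -> derivable F x v) /\
               class_C k' U (fun x => 'D_v F x)
   else True).

Definition smooth_on (R : realType) (V W : normedModType R) (U : set V)
    (F : V -> W) : Prop := forall k, class_C k U F.

(* A chart is a map [cmap] on a subset [cdom] of M, with inverse [cinv].  The
   values of [cmap] outside [cdom], and those of [cinv] outside the coordinate
   domain [cimg], are irrelevant. *)
Record atlas (R : realType) (n : nat) (M : Type) := Atlas {
  chart :> Type;
  cdom : chart -> set M;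
  cmap : chart -> M -> 'rV[R]_n;
  cinv : chart -> 'rV[R]_n -> M }.

Section Atlas.
Context {R : realType} {n : nat} {M : topologicalType} (A : atlas R n M).

Definition cimg (i : A) : set 'rV[R]_n := cmap i @` cdom i.

Definition overlap (i j : A) : set 'rV[R]_n := cmap i @` (cdom i `&` cdom j).
Definition transition (i j : A) (x : 'rV[R]_n) : 'rV[R]_n :=
  cmap j (cinv i x).

(* A is a smooth atlas of the open subset N of M. *)
Definition smooth_atlas (N : set M) : Prop :=
  [/\ \bigcup_(i in [set: A]) cdom i = N,
      forall i : A, open (cdom i) /\ open (cimg i),
      forall (i : A) p, cdom i p ->
        cinv i (cmap i p) = p /\ {for p, continuous (cmap i)},
      forall (i : A) x, cimg i x -> {for x, continuous (cinv i)} &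
      forall i j : A, smooth_on (overlap i j) (transition i j)].

Definition smooth_manifold : Prop :=
  [/\ hausdorff_space M, @second_countable M & smooth_atlas setT].

Definition smooth_function (u : M -> R) : Prop :=
  forall i : A, smooth_on (cimg i) (u \o cinv i).

Definition vfield := A -> 'rV[R]_n -> 'rV[R]_n.

(* Covariant tensor fields of order 2. *)
Definition tensor2 := A -> 'rV[R]_n -> 'M[R]_n.

Definition vector_field (X : vfield) : Prop :=
  (forall i, smooth_on (cimg i) (X i)) /\
  (forall i j x, overlap i j x ->
     X j (transition i j x) = 'D_(X i x) (transition i j) x).

Definition tensor_field (K : tensor2) : Prop :=
  (forall i, smooth_on (cimg i) (K i)) /\
  (forall i j x (u v : 'rV[R]_n), overlap i j x ->
     let tau := transition i j in
     u *m K i x *m v^T =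
     ('D_u tau x : 'rV[R]_n) *m K j (tau x) *m ('D_v tau x : 'rV[R]_n)^T).

Definition riemannian_metric (g : tensor2) : Prop :=
  [/\ tensor_field g,
      forall i x, cimg i x -> (g i x)^T = g i x &
      forall i x, cimg i x -> forall v : 'rV[R]_n, v != 0 ->
        0 < (v *m g i x *m v^T) 0 0].

(* X(u) at the point of coordinates x in the chart i. *)
Definition vf_apply (X : vfield) (u : M -> R) (i : A) (x : 'rV[R]_n) : R :=
  'D_(X i x) (u \o cinv i) x.

End Atlas.
Arguments vfield {R n M} A.
Arguments tensor2 {R n M} A.

Section Coordinates.
Context {R : realType} {n : nat}.
Implicit Types (G K : 'rV[R]_n -> 'M[R]_n) (X : 'rV[R]_n -> 'rV[R]_n).

Definition pderiv (i : 'I_n) (F : 'rV[R]_n -> R) (x : 'rV[R]_n) : R :=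
  'D_(delta_mx 0 i) F x.

(* (L_X K)_ab = X^m d_m K_ab + (d_a X^m) K_mb + (d_b X^m) K_am *)
Definition lie_derivative X K (x : 'rV[R]_n) : 'M[R]_n :=
  \matrix_(a, b) \sum_m
    (X x 0 m * pderiv m (fun y => K y a b) x
     + pderiv a (fun y => X y 0 m) x * K x m b
     + pderiv b (fun y => X y 0 m) x * K x a m).

(* Gamma^k_ij *)
Definition christoffel G (k i j : 'I_n) (x : 'rV[R]_n) : R :=
  2^-1 * \sum_l invmx (G x) k l *
    (pderiv i (fun y => G y j l) x + pderiv j (fun y => G y i l) x
     - pderiv l (fun y => G y i j) x).

(* R^l_kij, the l-th component of R(d_i, d_j) d_k, where
   R(X, Y) = [nabla_X, nabla_Y] - nabla_[X, Y] *)
Definition riemann G (l k i j : 'I_n) (x : 'rV[R]_n) : R :=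
  pderiv i (christoffel G l j k) x - pderiv j (christoffel G l i k) x
  + \sum_m (christoffel G l i m x * christoffel G m j k x
            - christoffel G l j m x * christoffel G m i k x).

Definition ricci G (x : 'rV[R]_n) : 'M[R]_n :=
  \matrix_(k, j) \sum_i riemann G i k i j x.

Definition scalar_curvature G (x : 'rV[R]_n) : R :=
  \sum_i \sum_j invmx (G x) i j * ricci G x i j.

End Coordinates.

Section Collineations.
Context {R : realType} {n : nat} {M : topologicalType} {A : atlas R n M}.
Implicit Types (g T : tensor2 A) (X : vfield A).

Definition conformal g X (rho : M -> R) : Prop :=
  forall i x, cimg i x ->
    lie_derivative (X i) (g i) x = rho (cinv i x) *: g i x.

Definition killing g X : Prop :=
  forall i x, cimg i x -> lie_derivative (X i) (g i) x = 0.

Definition matter_collineation T X : Prop :=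
  vector_field X /\
  forall i x, cimg i x -> lie_derivative (X i) (T i) x = 0.

Definition einstein_equation g (kappa lambda : R) T : Prop :=
  forall i x, cimg i x ->
    ricci (g i) x - (scalar_curvature (g i) x / 2) *: g i x =
    kappa *: T i x - lambda *: g i x.

End Collineations.

Section DoublyWarped.
Context {R : realType} {n : nat} {M : topologicalType}.
Variables (I : set R) (A : atlas R n M).

(* The product atlas of I `*` setT, as an open subset of R * M: the coordinates
   are (t, x), with x the coordinates in a chart of A. *)
Definition prod_atlas : atlas R (1 + n) (R * M)%type :=
  @Atlas R (1 + n) (R * M)%type A
    (fun i => I `*` cdom i)
    (fun i p => row_mx (const_mx p.1) (cmap i p.2))
    (fun i y => (lsubmx y 0 0, cinv i (rsubmx y))).

(* - f^2 dt^2 + sigma^2 g *)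
Definition doubly_warped (f : M -> R) (sigma : R -> R) (g : tensor2 A) :
    tensor2 prod_atlas := fun (i : A) y =>
  block_mx (const_mx (- f (cinv i (rsubmx y)) ^+ 2)) 0
           0 (sigma (lsubmx y 0 0) ^+ 2 *: g i (rsubmx y)).

(* h d/dt *)
Definition lift_time (h : R -> R) : vfield prod_atlas := fun (i : A) y =>
  row_mx (const_mx (h (lsubmx y 0 0))) 0.

Definition lift_space (X : vfield A) : vfield prod_atlas := fun (i : A) y =>
  row_mx 0 (X i (rsubmx y)).

Definition add_vfield (X Y : vfield prod_atlas) : vfield prod_atlas :=
  fun i y => X i y + Y i y.

End DoublyWarped.
Arguments doubly_warped {R n M I A} f sigma g.
Arguments lift_time {R n M I A} h.
Arguments lift_space {R n M I A} X.

(* Main.v *)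
(* If X = h d/dt + zeta satisfies f h' + zeta(f) = 0 and
   L_zeta g = -(2 h sigma'/sigma) g, then X is Killing for the doubly warped
   metric; each of the three parts is an instance of this (with zeta = 0, h = 0,
   or neither).  Killing fields preserve curvature: differentiating L_X G = 0 gives
     X(Gamma^k_ij) = - d_i d_j X^k
       + (d_m X^k) Gamma^m_ij - (d_i X^m) Gamma^k_mj - (d_j X^m) Gamma^k_im,
   differentiating once more gives L_X Riem = 0 because partial derivatives
   commute, and contracting gives L_X Ric = 0 and X(r) = 0.  By the field equation
   T is a combination of Ric, r G and G with constant coefficients. *)
Require Import Defs.
From HB Require Import structures.
From mathcomp Require Import all_boot all_order all_algebra.
From mathcomp Require Import all_classical all_reals all_analysis.
From mathcomp Require Import ring lra.
Import Order.TTheory GRing.Theory Num.Theory.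
Import numFieldNormedType.Exports.
Local Open Scope classical_set_scope.
Local Open Scope ring_scope.

Set Implicit Arguments.
Unset Strict Implicit.
Unset Printing Implicit Defensive.

(** * Functions of class C^k *)

(** [class_C] speaks of directional derivatives only, never of a total derivative. Additivity of
    ['D_v F] in v and the symmetry of second derivatives are therefore derived from the mean value
    theorem along lines. The intermediate curvature identities are not tensorial: X(Gamma) contains
    second derivatives of X, and X(d_a Gamma) third ones. To keep this bookkeeping apart from
    analysis, ['D_(X y)] is treated at each point y as a derivation with frozen direction, the
    derivatives of X become independent letters, and each identity is an identity between finite
    sums over a field. Analysis returns only when an equation valid on all of the open set U is
    differentiated once more. There d_c and X do not commute, and the correction (d_c X^m) d_m F is
    the content of [pderiv_along]. *)

Section ClassC.
Context {R : realType} {V W : normedModType R}.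
Implicit Types (U : set V) (F G : V -> W) (k : nat).

Lemma class_C_continuous k U F x : class_C k U F -> U x -> {for x, continuous F}.
Proof. by case: k => [|k] [+ _]; apply. Qed.

Lemma class_C_derivable k U F x v : class_C k.+1 U F -> U x -> derivable F x v.
Proof. by move=> [_ /(_ v)[+ _]]; apply. Qed.

Lemma class_C_derive k U F v :
  class_C k.+1 U F -> class_C k U (fun x => 'D_v F x).
Proof. by move=> [_ /(_ v)[_]]. Qed.

Lemma class_CS k U F : class_C k.+1 U F -> class_C k U F.
Proof.
elim: k F => [|k IH] F [cF dF]; split=> // v.
by split; [exact: (dF v).1|exact/IH/(dF v).2].
Qed.

Lemma class_C_subset k U U' F : U' `<=` U -> class_C k U F -> class_C k U' F.
Proof.
move=> sU; elim: k F => [|k IH] F [cF dF]; split=> //; first by move=> x /sU/cF.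
  by move=> x /sU/cF.
by move=> v; split; [move=> x /sU; exact: (dF v).1|exact/IH/(dF v).2].
Qed.

Lemma near_open U F G x : open U -> (forall y, U y -> F y = G y) -> U x ->
  \near x, F x = G x.
Proof.
move=> oU FG Ux; near=> y; apply: FG; near: y.
exact: open_nbhs_nbhs.
Unshelve. all: by end_near. Qed.

Lemma derive_ext U F G x v : open U -> (forall y, U y -> F y = G y) -> U x ->
  'D_v F x = 'D_v G x.
Proof.
by move=> oU FG Ux; apply: near_eq_derive; exact: near_open oU FG Ux.
Qed.

Lemma derivable_ext U F G x v : open U -> (forall y, U y -> F y = G y) -> U x ->
  derivable F x v -> derivable G x v.
Proof.
by move=> oU FG Ux; apply: near_eq_derivable; exact: near_open oU FG Ux.
Qed.

Lemma continuous_ext U F G x : open U -> (forall y, U y -> F y = G y) -> U x ->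
  {for x, continuous F} -> {for x, continuous G}.
Proof.
move=> oU FG Ux cF; rewrite /prop_for /continuous_at -(FG _ Ux).
apply: cvg_trans cF; apply: near_eq_cvg.
by apply: filterS (near_open oU FG Ux) => y ->.
Qed.

(** Derivative formulas such as the product rule hold only on U, so every induction on k has to
    replace a derivative by its formula there. Since U is open, a directional derivative at a point
    of U depends only on the values in U. *)
Lemma class_C_ext k U F G : open U -> (forall y, U y -> F y = G y) ->
  class_C k U F -> class_C k U G.
Proof.
move=> oU; elim: k F G => [|k IH] F G FG [cF dF]; split=> //.
- by move=> x Ux; apply: (continuous_ext oU FG Ux); exact: cF.
- by move=> x Ux; apply: (continuous_ext oU FG Ux); exact: cF.
move=> v; split; first by move=> x Ux; apply: (derivable_ext oU FG Ux); exact: (dF v).1.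
by apply: IH (dF v).2 => x Ux; exact: derive_ext oU FG Ux.
Qed.

Lemma smooth_ext U F G : open U -> (forall y, U y -> F y = G y) ->
  smooth_on U F -> smooth_on U G.
Proof. by move=> oU FG sF k; exact: class_C_ext oU FG (sF k). Qed.

Lemma smooth_subset U U' F : U' `<=` U -> smooth_on U F -> smooth_on U' F.
Proof. by move=> sU sF k; exact: class_C_subset sU (sF k). Qed.

Lemma smooth_derivable U F x v : smooth_on U F -> U x -> derivable F x v.
Proof. by move=> /(_ 1%N); exact: class_C_derivable. Qed.

Lemma smooth_derive U F v : smooth_on U F -> smooth_on U (fun x => 'D_v F x).
Proof. by move=> sF k; exact: class_C_derive. Qed.

Lemma class_C_cst k U (c : W) : class_C k U (fun=> c).
Proof.
elim: k c => [|k IH] c; split=> //; try by move=> x _; exact: cvg_cst.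
move=> v; split; first by move=> x _; exact: derivable_cst.
suff -> : (fun x => 'D_v (fun=> c) x) = (fun=> 0 : W) by exact: IH.
by apply/funext => x; exact: (derive_cst c x v).
Qed.

Lemma class_CD k U F G : open U -> class_C k U F -> class_C k U G ->
  class_C k U (fun x => F x + G x).
Proof.
move=> oU; elim: k F G => [|k IH] F G [cF dF] [cG dG]; split=> //.
- by move=> x Ux; apply: cvgD; [exact: cF|exact: cG].
- by move=> x Ux; apply: cvgD; [exact: cF|exact: cG].
move=> v; have [dFv CF] := dF v; have [dGv CG] := dG v; split.
  by move=> x Ux; apply: derivableD; [exact: dFv|exact: dGv].
apply: class_C_ext (IH _ _ CF CG) => // x Ux.
by rewrite -deriveD //; [exact: dFv|exact: dGv].
Qed.

Lemma smooth_cst U (c : W) : smooth_on U (fun=> c).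
Proof. by move=> k; exact: class_C_cst. Qed.

Lemma smoothD U F G : open U -> smooth_on U F -> smooth_on U G ->
  smooth_on U (fun x => F x + G x).
Proof. by move=> oU sF sG k; exact: class_CD. Qed.

Lemma smooth_sum U (I : Type) (r : seq I) (P : pred I) (F : I -> V -> W) :
  open U -> (forall i, P i -> smooth_on U (F i)) ->
  smooth_on U (fun x => \sum_(i <- r | P i) F i x).
Proof.
move=> oU sF; elim: r => [|i r IH].
  by apply: smooth_ext (smooth_cst U (0 : W)) => // x _; rewrite big_nil.
have [Pi|/negbTE Pi] := boolP (P i).
  by apply: smooth_ext (smoothD oU (sF i Pi) IH) => // x _; rewrite big_cons Pi.
by apply: smooth_ext IH => // x _; rewrite big_cons Pi.
Qed.

End ClassC.

(** * Composition with continuous linear maps *)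

Section Linear.
Context {R : realType} {V V' W W' : normedModType R}.

Lemma class_C_postcomp (L : {linear W -> W'}) k (U : set V) (F : V -> W) :
  continuous L -> open U -> class_C k U F -> class_C k U (L \o F).
Proof.
move=> cL oU; elim: k F => [|k IH] F [cF dF]; split=> //.
- by move=> x Ux; apply: continuous_comp; [exact: cF|exact: cL].
- by move=> x Ux; apply: continuous_comp; [exact: cF|exact: cL].
move=> v; have [dFv CF] := dF v.
(* L passes through the difference quotient by linearity and through the limit by continuity. *)
have LF x : U x -> h^-1 *: ((L \o F) (h *: v + x) - (L \o F) x) @[h --> 0^'] --> L ('D_v F x).
  move=> Ux.
  have -> : (fun h : R => h^-1 *: ((L \o F) (h *: v + x) - (L \o F) x)) =
      L \o (fun h => h^-1 *: (F (h *: v + x) - F x)).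
    by apply/funext => h; rewrite /= -linearB -linearZZ.
  by apply: (cvg_comp _ _ (dFv _ Ux)); exact: cL.
split; first by move=> x Ux; apply/cvg_ex; exists (L ('D_v F x)); exact: LF.
apply: class_C_ext (IH _ CF) => // x Ux.
by apply/esym; apply: cvg_lim; [exact: norm_hausdorff|exact: LF].
Qed.

Lemma smooth_postcomp (L : {linear W -> W'}) (U : set V) (F : V -> W) :
  continuous L -> open U -> smooth_on U F -> smooth_on U (L \o F).
Proof. by move=> cL oU sF k; exact: class_C_postcomp. Qed.

(** The difference quotients coincide before any limit is taken, so the identity also covers points
    where the limit fails to exist and the derivative is a default value. *)
Lemma derive_precomp (L : {linear V' -> V}) (F : V -> W) v x :
  'D_v (F \o L) x = 'D_(L v) F (L x).
Proof.
rewrite /derive; suff -> : (fun h => h^-1 *: ((F \o L) (h *: v + x) - (F \o L) x)) =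
  (fun h => h^-1 *: (F (h *: L v + L x) - F (L x))) by [].
by apply/funext => h /=; rewrite linearP.
Qed.

Lemma derivable_precomp (L : {linear V' -> V}) (F : V -> W) v x :
  derivable F (L x) (L v) -> derivable (F \o L) x v.
Proof.
rewrite /derivable; suff -> : (fun h => h^-1 *: (F (h *: L v + L x) - F (L x))) =
  (fun h => h^-1 *: ((F \o L) (h *: v + x) - (F \o L) x)) by [].
by apply/funext => h /=; rewrite linearP.
Qed.

Lemma class_C_precomp (L : {linear V' -> V}) k (U : set V) (F : V -> W) :
  continuous L -> class_C k U F -> class_C k (L @^-1` U) (F \o L).
Proof.
move=> cL; elim: k F => [|k IH] F [cF dF]; split=> //.
- by move=> x Ux; apply: continuous_comp; [exact: cL|exact: cF].
- by move=> x Ux; apply: continuous_comp; [exact: cL|exact: cF].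
move=> v; split; first by move=> x Ux; apply: derivable_precomp; exact: (dF _).1.
have -> : (fun x => 'D_v (F \o L) x) = (fun x => 'D_(L v) F x) \o L.
  by apply/funext => x; rewrite derive_precomp.
exact/IH/(dF _).2.
Qed.

Lemma smooth_precomp (L : {linear V' -> V}) (U : set V) (F : V -> W) :
  continuous L -> smooth_on U F -> smooth_on (L @^-1` U) (F \o L).
Proof. by move=> cL sF k; exact: class_C_precomp. Qed.

End Linear.

Section RealValued.
Context {R : realType} {V : normedModType R}.
Implicit Types (U : set V) (F G : V -> R) (k : nat).

Lemma class_CM k U F G : open U -> class_C k U F -> class_C k U G ->
  class_C k U (fun x => F x * G x).
Proof.
move=> oU; elim: k F G => [|k IH] F G CF CG.
  split=> // x Ux; apply: cvgM; [exact: CF.1|exact: CG.1].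
split; first by move=> x Ux; apply: cvgM; [exact: CF.1|exact: CG.1].
move=> v; have [dFv CFv] := CF.2 v; have [dGv CGv] := CG.2 v; split.
  by move=> x Ux; apply: derivableM; [exact: dFv|exact: dGv].
(* The product rule mixes the factors with their derivatives, so the factors are first lowered from
   order k+1 to order k by [class_CS]. *)
have CFG := class_CD oU (IH _ _ (class_CS CF) CGv) (IH _ _ (class_CS CG) CFv).
apply: class_C_ext CFG => // x Ux.
by apply/esym; rewrite [LHS]deriveM//; [exact: dFv|exact: dGv].
Qed.

Lemma smoothM U F G : open U -> smooth_on U F -> smooth_on U G ->
  smooth_on U (fun x => F x * G x).
Proof. by move=> oU sF sG k; exact: class_CM. Qed.

Lemma smoothN U F : open U -> smooth_on U F -> smooth_on U (fun x => - F x).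
Proof.
move=> oU sF; apply: smooth_ext (smoothM oU (smooth_cst U (-1 : R)) sF) => // x _.
by rewrite mulN1r.
Qed.

Lemma smoothB U F G : open U -> smooth_on U F -> smooth_on U G ->
  smooth_on U (fun x => F x - G x).
Proof. by move=> oU sF sG; apply: smoothD => //; exact: smoothN. Qed.

Lemma smooth_prod U (I : Type) (r : seq I) (P : pred I) (F : I -> V -> R) :
  open U -> (forall i, P i -> smooth_on U (F i)) ->
  smooth_on U (fun x => \prod_(i <- r | P i) F i x).
Proof.
move=> oU sF; elim: r => [|i r IH].
  by apply: smooth_ext (smooth_cst U (1 : R)) => // x _; rewrite big_nil.
have [Pi|/negbTE Pi] := boolP (P i).
  by apply: smooth_ext (smoothM oU (sF i Pi) IH) => // x _; rewrite big_cons Pi.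
by apply: smooth_ext IH => // x _; rewrite big_cons Pi.
Qed.

(** The derivative of 1/F is - F^-2 F', which involves 1/F itself: C^k for 1/F gives C^(k+1), with F
    fixed throughout the induction. *)
Lemma smoothV U F : open U -> smooth_on U F -> (forall x, U x -> F x != 0) ->
  smooth_on U (fun x => (F x)^-1).
Proof.
move=> oU sF F0; elim=> [|k IH].
  by split=> // x Ux; apply: cvgV; [exact: F0|exact: (sF 0%N).1].
split; first by move=> x Ux; apply: cvgV; [exact: F0|exact: (sF 0%N).1].
move=> v; split.
  by move=> x Ux; apply: derivableV; [exact: F0|exact: smooth_derivable sF Ux].
have C := class_CM oU (class_CM oU (class_C_cst k U (-1 : R))
  (class_CM oU IH IH)) (smooth_derive v sF k).
apply: class_C_ext C => // x Ux.
apply/esym; rewrite [LHS]deriveV; [|exact: F0|exact: smooth_derivable sF Ux].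
by rewrite /GRing.scale /= -exprVn expr2 mulN1r.
Qed.

End RealValued.

(** * Symmetry of second derivatives *)

Section SecondOrder.
Context {R : realType} {V : normedModType R}.
Implicit Types (U : set V) (F : V -> R).

(** Restriction to the line through x with direction v gives a function of one real variable, where
    derivability amounts to differentiability. Homogeneity in the direction and the chain rule for
    [ln] are both obtained this way. *)
Lemma derive_line F x v a :
  'D_(a *: v) F x = 'D_a (fun t : R => F (t *: v + x)) 0.
Proof.
rewrite /derive.
suff -> : (fun h : R => h^-1 *: (F (h *: (a *: v) + x) - F x)) =
  (fun h : R => h^-1 *: (F ((h *: a + 0) *: v + x) - F (0 *: v + x))) by [].
by apply/funext => h; rewrite addr0 scale0r add0r scalerA.
Qed.

Lemma deriveZv F x v a : derivable F x v -> 'D_(a *: v) F x = a * 'D_v F x.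
Proof.
move=> /derivable1P/derivable1_diffP dF.
rewrite derive_line -[v in RHS]scale1r derive_line !deriveE//.
by rewrite -[a in LHS]mulr1 -[a * 1]/(a *: (1 : R)) linearZZ.
Qed.

Lemma derivable_along F x v t : derivable F (t *: v + x) v ->
  is_derive t 1 (fun s : R => F (s *: v + x)) ('D_v F (t *: v + x)).
Proof.
have E : (fun h : R => h^-1 *: (F (h *: v + (t *: v + x)) - F (t *: v + x))) =
  (fun h : R => h^-1 *: (F ((h *: 1 + t) *: v + x) - F (t *: v + x))).
  by apply/funext => h; rewrite addrA -scalerDl [h *: 1]mulr1.
move=> dF; apply: DeriveDef.
  by move: dF; rewrite /derivable E.
by rewrite /derive E.
Qed.

Lemma mvt_line F x v s : 0 < s ->
  (forall t, 0 <= t <= s -> derivable F (t *: v + x) v) ->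
  exists2 c, 0 < c < s & F (s *: v + x) - F x = s * 'D_v F (c *: v + x).
Proof.
move=> s0 dF.
have [||c] := @MVT R (fun t => F (t *: v + x)) (fun t => 'D_v F (t *: v + x)) 0 s s0.
- move=> t; rewrite in_itv /= => /andP[t0 ts]; apply: derivable_along; apply: dF.
  by rewrite !ltW.
- apply: derivable_within_continuous => t; rewrite in_itv /= => ts.
  by have [] := derivable_along (dF t ts).
rewrite in_itv /= => cs; rewrite scale0r add0r subr0 mulrC => ->.
by exists c.
Qed.

Lemma near_plane (P : set V) x u v : nbhs x P ->
  exists2 d : R, 0 < d & forall a b, 0 <= a < d -> 0 <= b < d ->
    P (a *: u + (b *: v + x)).
Proof.
move=> /nbhs_normP[e /= e0 eP].
(* The displacement has norm at most max(a, b) (|u| + |v|); the added 1 keeps the denominator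
   positive when u = v = 0. *)
have m0 : 0 < `|u| + `|v| + 1 by rewrite ltr_wpDl // addr_ge0.
exists (e / (`|u| + `|v| + 1)); first exact: divr_gt0.
move=> a b /andP[a0 ad] /andP[b0 bd]; apply: eP; rewrite /ball_ /=.
rewrite addrA opprD addrCA subrr addr0 normrN.
move: ad bd; rewrite !ltr_pdivlMr // => ad bd.
apply: le_lt_trans (ler_normD _ _) _; rewrite !normrZ !ger0_norm //.
have := normr_ge0 u; have := normr_ge0 v => v0 u0.
have [ab|ba] := leP a b.
  apply: le_lt_trans bd; rewrite !mulrDr mulr1.
  have := ler_wpM2r u0 ab; lra.
apply: le_lt_trans ad; rewrite !mulrDr mulr1.
have := ler_wpM2r v0 (ltW ba); lra.
Qed.

(** The increment from x to s(u + v) + x is split at su + x. The second leg is s times ['D_v F] at a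
    point near x, by the mean value theorem, and continuity of ['D_v F] brings that point back to
    x. *)
Lemma deriveDv U F x u v : open U -> class_C 1 U F -> U x ->
  'D_(u + v) F x = 'D_u F x + 'D_v F x.
Proof.
move=> oU CF Ux; apply/eqP; rewrite eq_sym -subr_eq0 -normr_le0.
apply/ler_addgt0Pr => e e0; rewrite add0r.
(* Three errors add up: the difference quotients of F at x along u and along u + v, and the
   variation of ['D_v F] near x. *)
have e4 : 0 < e / 3 by apply: divr_gt0.
have cv : {for x, continuous (fun y => 'D_v F y)}.
  have H := class_C_continuous (class_C_derive v CF) Ux.
  exact: H.
have [d d0 dP] : exists2 d : R, 0 < d & forall a b, 0 <= a < d -> 0 <= b < d ->
    (U `&` [set y | `|'D_v F x - 'D_v F y| < e / 3]) (a *: v + (b *: u + x)).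
  apply: near_plane; apply: filterI; first exact: open_nbhs_nbhs.
  by move/cvgrPdist_lt : cv => /(_ _ e4).
(* The right-hand limit is taken because [mvt_line] asks for s > 0. *)
have quot w : \forall h \near (0:R)^'+, `|'D_w F x - h^-1 * (F (h *: w + x) - F x)| < e / 3.
  have /cvg_dnbhs_at_right/cvgrPdist_lt/(_ _ e4) := class_C_derivable (v := w) CF Ux.
  exact.
near (0:R)^'+ => s.
have s0 : 0 < s by near: s; exact: nbhs_right_gt.
have sd : s < d by near: s; exact: nbhs_right_lt.
have [||c /andP[c0 cs] E] := @mvt_line F (s *: u + x) v s.
- by [].
- move=> t /andP[t0 ts]; apply: (class_C_derivable CF).
  have := (dP t s); rewrite (ltW s0) sd t0 (le_lt_trans ts sd) => /(_ isT isT)[]//.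
have := dP c s; rewrite (ltW s0) sd (ltW c0) (lt_trans cs sd) => /(_ isT isT)[_ /=].
have : `|'D_u F x - s^-1 * (F (s *: u + x) - F x)| < e / 3 by near: s; exact: quot.
have : `|'D_(u+v) F x - s^-1 * (F (s *: (u+v) + x) - F x)| < e / 3 by near: s; exact: quot.
have -> : F (s *: (u + v) + x) - F x =
  s * 'D_v F (c *: v + (s *: u + x)) + (F (s *: u + x) - F x).
  by rewrite -E scalerDr addrAC subrKA addrC addrA.
rewrite mulrDr mulKf ?gt_eqF //.
set A := 'D_v F (c *: v + _); set B := _ * _.
rewrite !ltr_norml ler_norml; lra.
Unshelve. all: by end_near. Qed.

(** The mean value theorem is applied twice: along v to the increment G of F in the direction su,
    then along u to ['D_v F]. *)
Lemma second_difference U F x u v s : 0 < s ->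
  (forall a b, 0 <= a <= s -> 0 <= b <= s -> U (a *: u + (b *: v + x))) ->
  class_C 2 U F ->
  exists a b, [/\ 0 < a < s, 0 < b < s &
    F (s *: u + (s *: v + x)) - F (s *: u + x) - F (s *: v + x) + F x =
    s * (s * 'D_u (fun y => 'D_v F y) (a *: u + (b *: v + x)))].
Proof.
move=> s0 Us CF.
pose G y := F (s *: u + y) - F y.
have ss : 0 <= s <= s by rewrite lexx ltW.
have s00 : 0 <= (0:R) <= s by rewrite lexx ltW.
have dsh y w : derivable F (s *: u + y) w ->
    derivable (fun y => F (s *: u + y)) y w /\
    'D_w (fun y => F (s *: u + y)) y = 'D_w F (s *: u + y).
  have E : (fun h => h^-1 *: (F (h *: w + (s *: u + y)) - F (s *: u + y))) =
      (fun h => h^-1 *: (F (s *: u + (h *: w + y)) - F (s *: u + y))).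
    by apply/funext => h; rewrite addrCA.
  by rewrite /derivable /derive E.
have dG t : 0 <= t <= s -> derivable G (t *: v + x) v /\
    'D_v G (t *: v + x) = 'D_v F (s *: u + (t *: v + x)) - 'D_v F (t *: v + x).
  move=> ts.
  have d1 : derivable F (s *: u + (t *: v + x)) v by apply: (class_C_derivable CF); exact: Us.
  have d2 : derivable F (t *: v + x) v.
    by apply: (class_C_derivable CF); have := Us 0 t; rewrite scale0r add0r; exact.
  have [d3 E] := dsh _ _ d1.
  split; first exact: derivableB.
  by rewrite -E; exact: deriveB.
have [t ts|b /andP[b0 bs] E1] := @mvt_line G x v s s0; first by have [] := dG t ts.
have bs' : 0 <= b <= s by rewrite !ltW.
have [t ts|a /andP[a0 as_] E2] :=
    @mvt_line (fun y => 'D_v F y) (b *: v + x) u s s0.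
  by apply: (class_C_derivable (class_C_derive v CF)); exact: Us.
exists a, b; split; [by rewrite a0|by rewrite b0|].
rewrite -E2; have [_ <-] := dG b bs'.
rewrite -E1 /G; ring.
Qed.

(** The second difference over a parallelogram is symmetric in u and v. Hence each mixed derivative
    takes, somewhere in a small parallelogram at x, one common value, and continuity at x makes the
    two equal there. *)
Lemma deriveC U F x u v : open U -> class_C 2 U F -> U x ->
  'D_u (fun y => 'D_v F y) x = 'D_v (fun y => 'D_u F y) x.
Proof.
move=> oU CF Ux; apply/eqP; rewrite -subr_eq0 -normr_le0.
apply/ler_addgt0Pr => e e0; rewrite add0r.
have e2 : 0 < e / 2 by apply: divr_gt0.
have near w w' : exists2 d : R, 0 < d & forall a b, 0 <= a < d -> 0 <= b < d ->
    (U `&` [set y | `|'D_w (fun y => 'D_w' F y) x - 'D_w (fun y => 'D_w' F y) y| < e / 2])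
    (a *: w + (b *: w' + x)).
  apply: near_plane; apply: filterI; first exact: open_nbhs_nbhs.
  have := class_C_continuous (class_C_derive w (class_C_derive w' CF)) Ux.
  by move/cvgrPdist_lt => /(_ _ e2).
have [d d0 dP] := near u v; have [d' d'0 dP'] := near v u.
(* Halving makes s strictly smaller than both d and d', so the closed parallelogram of side s stays
   inside both neighbourhoods. *)
pose s := Num.min d d' / 2.
have m0 : 0 < Num.min d d' by rewrite lt_min d0.
have s0 : 0 < s by rewrite divr_gt0.
have sm : s < Num.min d d' by rewrite /s ltr_pdivrMr // ltr_pMr // ltr1n.
have [sd sd'] : s < d /\ s < d' by move: sm; rewrite lt_min => /andP[].
have [|a [b [/andP[a0 a1] /andP[b0 b1] E]]] := @second_difference U F x u v s s0 _ CF.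
  move=> a b /andP[a0 a1] /andP[b0 b1].
  by have [] := dP a b; rewrite ?a0 ?b0 ?(le_lt_trans a1 sd) ?(le_lt_trans b1 sd).
have [|a' [b' [/andP[a'0 a'1] /andP[b'0 b'1] E']]] := @second_difference U F x v u s s0 _ CF.
  move=> a' b' /andP[a'0 a'1] /andP[b'0 b'1].
  by have [] := dP' a' b'; rewrite ?a'0 ?b'0 ?(le_lt_trans a'1 sd') ?(le_lt_trans b'1 sd').
have := dP a b; rewrite (ltW a0) (ltW b0) (lt_trans a1 sd) (lt_trans b1 sd) => /(_ isT isT)[_ /=].
have := dP' a' b'; rewrite (ltW a'0) (ltW b'0) (lt_trans a'1 sd') (lt_trans b'1 sd') => /(_ isT isT)[_ /=].
(* [E] and [E'] evaluate the same second difference; the factor s is cancelled twice. *)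
have -> : 'D_v (fun y => 'D_u F y) (a' *: v + (b' *: u + x)) =
  'D_u (fun y => 'D_v F y) (a *: u + (b *: v + x)).
  have s_neq0 : s != 0 by rewrite gt_eqF.
  apply: (mulfI s_neq0); apply: (mulfI s_neq0).
  rewrite -[RHS]E -[LHS]E'; rewrite [s *: v + (_ + _)]addrCA.
  by congr (_ + _); exact: addrAC.
move: ('D_u (fun y => 'D_v F y) x) ('D_v (fun y => 'D_u F y) x) => A B.
move: ('D_u _ (a *: _ + _)) => C BC AC.
have -> : A - B = (A - C) - (B - C) by rewrite opprB addrA subrK.
by rewrite (le_trans (ler_normB _ _)) // [leRHS]splitr lerD // ltW.
Qed.

End SecondOrder.

(** * Lie derivatives of curvature: index identities *)

(* The letters stand for values at one point: [B a m] is d_a X^m, [H a b m] is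
   d_a d_b X^m, [H3 a b c m] is d_a d_b d_c X^m, [E c a b] is d_c G_ab and [DF] is
   X(F).  In the first two lemmas on Christoffel symbols [C i j l] is the symbol of
   the first kind (doubled); from [lie_christoffel_square] on, [C k i j] is the
   symbol of the second kind, Gamma^k_ij. *)
Section LieAlgebra.
Context {R : fieldType} {n : nat}.
Implicit Types (B G P : 'I_n -> 'I_n -> R) (H C E : 'I_n -> 'I_n -> 'I_n -> R).

(** The hypothesis on [DGi] is the derivative of Gi G = 1. Substituting the Killing equation for
    [DG] and cancelling G on the right gives the vanishing of the Lie derivative of the inverse
    metric. *)
Lemma lie_inverse (G DG Gi DGi B : 'M[R]_n) :
  Gi *m G = 1%:M -> G *m Gi = 1%:M -> DGi *m G + Gi *m DG = 0 ->
  DG + B *m G + G *m B^T = 0 ->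
  DGi = Gi *m B + B^T *m Gi.
Proof.
move=> GiG GGi DGiG DGE.
have E1 : DG = - (B *m G + G *m B^T).
  by apply/eqP; rewrite -addr_eq0 addrA DGE.
have : DGi *m G = Gi *m B *m G + B^T.
  apply/eqP; rewrite -subr_eq0 -DGiG E1 mulmxN mulmxDr !mulmxA GiG mul1mx.
  by rewrite opprD.
move=> /(congr1 (mulmx^~ Gi)).
by rewrite mulmxDl -!mulmxA GGi !mulmx1.
Qed.

(** Of the six second-derivative terms, four cancel in pairs by the symmetry of H and G. The two
    left are equal, whence the factor 2. *)
Lemma lie_christoffel_first B G E DE H C DC :
  (forall a b, G a b = G b a) ->
  (forall a b m, H a b m = H b a m) ->
  (forall c a b, DE c a b = - \sum_m (B c m * E m a b + H c a m * G m b
     + B a m * E c m b + H c b m * G a m + B b m * E c a m)) ->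
  (forall i j l, C i j l = E i j l + E j i l - E l i j) ->
  (forall i j l, DC i j l = DE i j l + DE j i l - DE l i j) ->
  forall i j l, DC i j l = - \sum_m (B i m * C m j l + B j m * C i m l
     + B l m * C i j m) - 2 * \sum_m H i j m * G m l.
Proof.
move=> GC HC DEE CE DCE i j l; rewrite DCE !DEE mulr_sumr.
rewrite -!sumrN -!big_split /=; apply: eq_bigr => m _.
rewrite !CE (HC j i) (HC l i) (HC l j) (GC j m); ring.
Qed.

(** Raising the last index with Gi: the part of [DGi] that acts on the contracted index cancels the
    [B l m] term of [DC] after relabelling ([S2]). *)
Lemma lie_christoffel_second B (Gi G : 'M[R]_n) DGi H C DC Gam DGam :
  (2 : R) != 0 ->
  (forall a b, G a b = G b a) -> Gi *m G = 1%:M ->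
  (forall k l, DGi k l = \sum_m (B m k * Gi m l + B m l * Gi k m)) ->
  (forall i j l, DC i j l = - \sum_m (B i m * C m j l + B j m * C i m l
     + B l m * C i j m) - 2 * \sum_m H i j m * G m l) ->
  (forall k i j, Gam k i j = 2^-1 * \sum_l Gi k l * C i j l) ->
  (forall k i j, DGam k i j =
     2^-1 * \sum_l (DGi k l * C i j l + Gi k l * DC i j l)) ->
  forall k i j, DGam k i j = - H i j k + \sum_m (B m k * Gam m i j
     - B i m * Gam k m j - B j m * Gam k i m).
Proof.
move=> two0 GC GiG DGiE DCE GamE DGamE k i j; rewrite DGamE.
have HE : H i j k = \sum_l \sum_m Gi k l * (H i j m * G m l).
  have GiGE m : \sum_l Gi k l * G m l = (k == m)%:R.
    move/matrixP: GiG => /(_ k m); rewrite !mxE => <-.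
    by apply: eq_bigr => l _; rewrite GC.
  rewrite exchange_big /= (bigD1 k) //= [X in _ + X]big1 ?addr0 => [|m mk].
    transitivity (H i j k * (k == k)%:R); first by rewrite eqxx mulr1.
    by rewrite -GiGE mulr_sumr; apply: eq_bigr => l _; rewrite mulrCA.
  transitivity (H i j m * (k == m)%:R); last by rewrite eq_sym (negbTE mk) mulr0.
  by rewrite -GiGE mulr_sumr; apply: eq_bigr => l _; rewrite mulrCA.
have S1 : \sum_m (B m k * Gam m i j - B i m * Gam k m j - B j m * Gam k i m) =
  2^-1 * \sum_l \sum_m (B m k * (Gi m l * C i j l) - B i m * (Gi k l * C m j l)
     - B j m * (Gi k l * C i m l)).
  rewrite exchange_big mulr_sumr; apply: eq_bigr => m _.
  rewrite !GamE !big_split /= -!mulr_sumr !sumrN -!mulr_sumr; ring.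
have S2 : \sum_l \sum_m B m l * (Gi k m * C i j l) =
    \sum_l \sum_m Gi k l * (B l m * C i j m).
  by rewrite exchange_big; apply: eq_bigr => l _; apply: eq_bigr => m _; ring.
have S3 : \sum_l (DGi k l * C i j l + Gi k l * DC i j l) =
  \sum_l \sum_m (B m k * (Gi m l * C i j l) - B i m * (Gi k l * C m j l)
     - B j m * (Gi k l * C i m l))
  + (\sum_l \sum_m B m l * (Gi k m * C i j l) -
     \sum_l \sum_m Gi k l * (B l m * C i j m))
  - 2 * \sum_l \sum_m Gi k l * (H i j m * G m l).
  rewrite mulr_sumr -!sumrN -!big_split /=; apply: eq_bigr => l _.
  rewrite DGiE DCE !(mulr_sumr, mulr_suml, mulrDr, mulrN) -!sumrN -!big_split /=.
  by apply: eq_bigr => m _; ring.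
rewrite S3 S2 S1 HE.
set X := \sum_l _; set Y := \sum_l _; set Z := \sum_l _; field; done.
Qed.

(** S is the quadratic part of the curvature. The B terms on the contracted index p cancel ([S2]),
    while the inhomogeneous H terms survive and are absorbed in [lie_riemann]. *)
Lemma lie_christoffel_square B H C DC S DS :
  (forall k i j, DC k i j = - H i j k + \sum_m (B m k * C m i j
     - B i m * C k m j - B j m * C k i m)) ->
  (forall l k i j, S l k i j = \sum_p C l i p * C p j k) ->
  (forall l k i j, DS l k i j =
     \sum_p (DC l i p * C p j k + C l i p * DC p j k)) ->
  forall l k i j : 'I_n, DS l k i j =
    - \sum_m (H i m l * C m j k + C l i m * H j k m)
    + \sum_m (B m l * S m k i j - B i m * S l k m j - B j m * S l k i m
              - B k m * S l m i j).
Proof.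
move=> DCE SE DSE l k i j; rewrite DSE.
have S1 : \sum_m (B m l * S m k i j - B i m * S l k m j - B j m * S l k i m
              - B k m * S l m i j) =
  \sum_p \sum_m (B m l * (C m i p * C p j k) - B i m * (C l m p * C p j k)
     - B j m * (C l i p * C p m k) - B k m * (C l i p * C p j m)).
  rewrite exchange_big; apply: eq_bigr => m _.
  rewrite !SE !big_split /= -!mulr_sumr !sumrN -!mulr_sumr; ring.
have S2 : \sum_p \sum_m B p m * (C l i m * C p j k) =
    \sum_p \sum_m C l i p * (B m p * C m j k).
  by rewrite exchange_big; apply: eq_bigr => p _; apply: eq_bigr => m _; ring.
have -> : \sum_p (DC l i p * C p j k + C l i p * DC p j k) =
   - \sum_m (H i m l * C m j k + C l i m * H j k m) +
  \sum_p \sum_m (B m l * (C m i p * C p j k) - B i m * (C l m p * C p j k)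
     - B j m * (C l i p * C p m k) - B k m * (C l i p * C p j m))
  + (\sum_p \sum_m C l i p * (B m p * C m j k) -
     \sum_p \sum_m B p m * (C l i m * C p j k)).
  rewrite -!sumrN -!big_split /=; apply: eq_bigr => p _.
  rewrite !DCE !(mulr_sumr, mulr_suml, mulrDr, mulrDl, mulrN) -!sumrN.
  rewrite -addrA -!big_split /= addrACA -big_split /= mulNr; congr (_ + _).
    ring.
  by apply: eq_bigr => m _; ring.
by rewrite S1 S2 subrr addr0.
Qed.

(** Antisymmetry in i and j removes the third derivatives [H3]. The H terms coming from the
    derivatives of the Christoffel symbols cancel those from their products, and only the tensorial
    B terms remain. *)
Lemma lie_riemann B H (H3 : 'I_n -> 'I_n -> 'I_n -> 'I_n -> R) C DC
    (dC DdC Rm DRm : 'I_n -> 'I_n -> 'I_n -> 'I_n -> R) :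
  (forall a b m, H a b m = H b a m) ->
  (forall a b c m, H3 a b c m = H3 b a c m) ->
  (forall k i j, DC k i j = - H i j k + \sum_m (B m k * C m i j
     - B i m * C k m j - B j m * C k i m)) ->
  (forall a k i j, DdC a k i j = - H3 a i j k + \sum_m
     (H a m k * C m i j + B m k * dC a m i j
      - (H a i m * C k m j + B i m * dC a k m j)
      - (H a j m * C k i m + B j m * dC a k i m))
     - \sum_m B a m * dC m k i j) ->
  (forall l k i j, Rm l k i j = dC i l j k - dC j l i k
     + \sum_p (C l i p * C p j k - C l j p * C p i k)) ->
  (forall l k i j, DRm l k i j = DdC i l j k - DdC j l i k
     + \sum_p (DC l i p * C p j k + C l i p * DC p j k
               - (DC l j p * C p i k + C l j p * DC p i k))) ->
  forall l k i j, DRm l k i j = \sum_m (B m l * Rm m k i j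
     - B k m * Rm l m i j - B i m * Rm l k m j - B j m * Rm l k i m).
Proof.
move=> HC H3C DCE DdCE RmE DRmE l k i j.
pose S l k i j := \sum_p C l i p * C p j k.
pose DS l k i j := \sum_p (DC l i p * C p j k + C l i p * DC p j k).
have DSE := @lie_christoffel_square B H C DC S DS DCE (fun _ _ _ _ => erefl)
  (fun _ _ _ _ => erefl).
have RmE' l' k' i' j' : Rm l' k' i' j' =
    dC i' l' j' k' - dC j' l' i' k' + (S l' k' i' j' - S l' k' j' i').
  by rewrite RmE /S sumrB.
rewrite DRmE sumrB -/(DS l k i j) -/(DS l k j i) !DSE !DdCE (H3C i j).
set h := H3 _ _ _ _.
(* The third-derivative term [h] drops out, and the other eight summands are aligned for merging
   into a single sum over m. *)
have -> (x1 x2 x3 x4 x5 x6 x7 x8 : R) : - h + x1 - x2 - (- h + x3 - x4)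
  + (- x5 + x6 - (- x7 + x8)) = x1 + - x2 + - x3 + x4 + - x5 + x6 + x7 + - x8.
  by ring.
rewrite -!sumrN -!big_split /=; apply: eq_bigr => m _.
rewrite !RmE' (HC j i); ring.
Qed.

(** On the contracted pair of indices, the term for the upper index and the term for the lower one
    have opposite signs and agree after exchanging the two summations. *)
Lemma lie_contract B (Rm DRm : 'I_n -> 'I_n -> 'I_n -> 'I_n -> R) Rc DRc :
  (forall l k i j, DRm l k i j = \sum_m (B m l * Rm m k i j
     - B k m * Rm l m i j - B i m * Rm l k m j - B j m * Rm l k i m)) ->
  (forall k j, Rc k j = \sum_i Rm i k i j) ->
  (forall k j, DRc k j = \sum_i DRm i k i j) ->
  forall k j, DRc k j = - \sum_m (B k m * Rc m j + B j m * Rc k m).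
Proof.
move=> DRmE RcE DRcE k j; rewrite DRcE.
under eq_bigr do rewrite DRmE.
have -> : \sum_m (B k m * Rc m j + B j m * Rc k m) =
    \sum_i \sum_m (B k m * Rm i m i j + B j m * Rm i k i m).
  rewrite exchange_big; apply: eq_bigr => m _.
  by rewrite !RcE big_split /= !mulr_sumr.
have E : \sum_i \sum_m B m i * Rm m k i j = \sum_i \sum_m B i m * Rm i k m j.
  by rewrite exchange_big.
apply/eqP; rewrite -subr_eq0 opprK -[X in _ == X](subrr (\sum_i \sum_m B m i * Rm m k i j)).
rewrite [in X in _ == _ - X]E -sumrB -big_split; apply/eqP/eq_bigr => i _ /=.
by rewrite -sumrB -big_split; apply: eq_bigr => m _ /=; ring.
Qed.

(** The transpose turns the trace into the double sum of [Gi i j * Rc i j] that defines the scalar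
    curvature; the terms then cancel because a trace is invariant under cyclic permutation. *)
Lemma lie_trace (Gi DGi Rc DRc B : 'M[R]_n) :
  DGi = Gi *m B + B^T *m Gi -> DRc + B *m Rc + Rc *m B^T = 0 ->
  \tr (DGi *m Rc^T) + \tr (Gi *m DRc^T) = 0.
Proof.
move=> -> E.
have -> : DRc = - (B *m Rc + Rc *m B^T).
  by apply/eqP; rewrite -addr_eq0 addrA E.
rewrite linearN /= linearD /= !trmx_mul trmxK mulmxDl mulmxN mulmxDr.
rewrite !mulmxA linearN !linearD /= -!mulmxA [\tr (B^T *m _)]mxtrace_mulC -!mulmxA.
by rewrite [X in _ - X]addrC subrr.
Qed.


End LieAlgebra.

(** * Lie derivatives of curvature along a Killing field *)

Section Rules.
Context {R : realType} {V : normedModType R} (U : set V) (oU : open U).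
Implicit Types (F G : V -> R).

Lemma deriveD_on F G x v : smooth_on U F -> smooth_on U G -> U x ->
  'D_v (fun y => F y + G y) x = 'D_v F x + 'D_v G x.
Proof. by move=> sF sG Ux; rewrite [LHS]deriveD //; apply: smooth_derivable Ux. Qed.

Lemma deriveN_on F x v : smooth_on U F -> U x ->
  'D_v (fun y => - F y) x = - 'D_v F x.
Proof. by move=> sF Ux; rewrite [LHS]deriveN //; apply: smooth_derivable Ux. Qed.

Lemma deriveB_on F G x v : smooth_on U F -> smooth_on U G -> U x ->
  'D_v (fun y => F y - G y) x = 'D_v F x - 'D_v G x.
Proof. by move=> sF sG Ux; rewrite [LHS]deriveB //; apply: smooth_derivable Ux. Qed.

Lemma deriveM_on F G x v : smooth_on U F -> smooth_on U G -> U x ->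
  'D_v (fun y => F y * G y) x = 'D_v F x * G x + F x * 'D_v G x.
Proof.
move=> sF sG Ux; rewrite [LHS]deriveM; try exact: smooth_derivable Ux.
by rewrite addrC [_ *: 'D_v F x]mulrC.
Qed.

Lemma deriveMl_on (c : R) F x v : smooth_on U F -> U x ->
  'D_v (fun y => c * F y) x = c * 'D_v F x.
Proof. by move=> sF Ux; rewrite [LHS]deriveMl //; apply: smooth_derivable Ux. Qed.

Lemma derive_sum_on n (F : 'I_n -> V -> R) x v :
  (forall i, smooth_on U (F i)) -> U x ->
  'D_v (fun y => \sum_i F i y) x = \sum_i 'D_v (F i) x.
Proof.
move=> sF Ux; rewrite -derive_sum => [|i]; last exact: smooth_derivable Ux.
by congr ('D_v _ x); apply/funext => y; rewrite fct_sumE.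
Qed.

Lemma smoothMl (c : R) F : smooth_on U F -> smooth_on U (fun y => c * F y).
Proof. by move=> sF; apply: smoothM => //; exact: smooth_cst. Qed.

End Rules.

(** * Partial derivatives and Lie derivatives in coordinates *)

Section Coords.
Context {R : realType} {n : nat} (U : set 'rV[R]_n) (oU : open U).
Implicit Types (F : 'rV[R]_n -> R) (X : 'rV[R]_n -> 'rV[R]_n).
Implicit Types (G K : 'rV[R]_n -> 'M[R]_n).

(** Linearity in the direction is where C^1 enters, through [deriveDv]; mere existence of
    directional derivatives would not give it. *)
Lemma deriveE_pderiv F x v : class_C 1 U F -> U x ->
  'D_v F x = \sum_m v 0 m * pderiv m F x.
Proof.
move=> CF Ux; rewrite {1}[v]row_sum_delta.
have Z m : 'D_(v 0 m *: delta_mx 0 m) F x = v 0 m * pderiv m F x.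
  by apply: deriveZv; exact: class_C_derivable CF Ux.
under [RHS]eq_bigr do rewrite -Z.
elim: (index_enum _) => [|m r IH]; first by rewrite !big_nil derive0.
by rewrite !big_cons (deriveDv _ _ oU CF Ux) IH.
Qed.

Lemma smooth_pderiv F a : smooth_on U F -> smooth_on U (pderiv a F).
Proof. exact: smooth_derive. Qed.

Lemma pderivC F x a b : smooth_on U F -> U x ->
  pderiv a (pderiv b F) x = pderiv b (pderiv a F) x.
Proof. by move=> sF Ux; exact: deriveC oU (sF 2%N) Ux. Qed.

Lemma deriveX_pderiv F X x : smooth_on U F -> U x ->
  'D_(X x) F x = \sum_m X x 0 m * pderiv m F x.
Proof. by move=> sF Ux; exact: deriveE_pderiv (sF 1%N) Ux. Qed.

(** The direction varies with the point, so smoothness is read off the expansion in partial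
    derivatives. *)
Lemma smooth_along F X : smooth_on U F ->
  (forall m, smooth_on U (fun y => X y 0 m)) ->
  smooth_on U (fun y => 'D_(X y) F y).
Proof.
move=> sF sX.
apply: (smooth_ext (F := fun y => \sum_m X y 0 m * pderiv m F y)) => //.
  by move=> y Uy; rewrite (deriveX_pderiv _ sF).
by apply: smooth_sum => // m _; apply: smoothM => //; exact: smooth_pderiv.
Qed.

(** This is the commutator of d_c with X. In the first term on the right the direction is frozen at
    X x; the sum accounts for the variation of X. *)
Lemma pderiv_along F X x c : smooth_on U F ->
  (forall m, smooth_on U (fun y => X y 0 m)) -> U x ->
  pderiv c (fun y => 'D_(X y) F y) x = 'D_(X x) (pderiv c F) x
    + \sum_m pderiv c (fun y => X y 0 m) x * pderiv m F x.
Proof.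
move=> sF sX Ux; rewrite {1}/pderiv.
rewrite (derive_ext (G := fun y => \sum_m X y 0 m * pderiv m F y) _ oU) //; last first.
  by move=> y Uy; exact: deriveX_pderiv.
rewrite (derive_sum_on (U := U)) //; last first.
  by move=> m; apply: smoothM => //; exact: smooth_pderiv.
rewrite (deriveX_pderiv _ (smooth_pderiv _ sF)) // addrC -big_split /=.
apply: eq_bigr => m _; rewrite (deriveM_on _ (sX m) (smooth_pderiv m sF) Ux).
by rewrite (pderivC m c sF Ux).
Qed.

(** The transport term becomes one directional derivative, to which the sum and product rules apply;
    the rest is linear in the matrix [K x]. *)
Lemma lie_derivativeE X K x a b : smooth_on U (fun y => K y a b) -> U x ->
  lie_derivative X K x a b = 'D_(X x) (fun y => K y a b) x
    + \sum_m (pderiv a (fun y => X y 0 m) x * K x m b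
              + pderiv b (fun y => X y 0 m) x * K x a m).
Proof.
move=> sK Ux; rewrite mxE (deriveX_pderiv _ sK) // -big_split /=.
by apply: eq_bigr => m _; rewrite addrA.
Qed.

Lemma smooth_det m (K : 'rV[R]_n -> 'M[R]_m) :
  (forall a b, smooth_on U (fun y => K y a b)) -> smooth_on U (fun y => \det (K y)).
Proof.
move=> sK; apply: smooth_sum => // s _; apply: smoothM => //.
  exact: smooth_cst.
by apply: smooth_prod.
Qed.

Lemma smooth_invmx K : (forall a b, smooth_on U (fun y => K y a b)) ->
  (forall y, U y -> K y \in unitmx) ->
  forall a b, smooth_on U (fun y => invmx (K y) a b).
Proof.
move=> sK Ku a b.
(* Cramer's formula makes each entry of the inverse a quotient of determinants. *)
apply: (smooth_ext (F := fun y => (\det (K y))^-1 * cofactor (K y) b a)) => //.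
  by move=> y Uy; rewrite /invmx Ku // !mxE.
apply: smoothM => //; first apply: smoothV => //.
- exact: smooth_det.
- by move=> y /Ku; rewrite unitmxE unitfE.
apply: smoothM => //; first exact: smooth_cst.
apply: smooth_det => i j.
by apply: smooth_ext (sK (lift b i) (lift a j)) => // y _; rewrite !mxE.
Qed.

End Coords.

(** * From the Killing equation on a coordinate domain to the Ricci and scalar curvatures *)

Section LieNatural.
Context {R : realType} {n : nat} (U : set 'rV[R]_n) (oU : open U).
Variables (X : 'rV[R]_n -> 'rV[R]_n) (G : 'rV[R]_n -> 'M[R]_n).
Hypothesis sX : forall m, smooth_on U (fun y => X y 0 m).
Hypothesis sG : forall a b, smooth_on U (fun y => G y a b).
Hypothesis symG : forall y, U y -> (G y)^T = G y.
Hypothesis unitG : forall y, U y -> G y \in unitmx.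
Hypothesis killG : forall y, U y -> lie_derivative X G y = 0.

Let B a m := pderiv a (fun y => X y 0 m).
Let H a b m := pderiv a (B b m).

Let sB a m : smooth_on U (B a m). Proof. exact: smooth_pderiv. Qed.
Let sH a b m : smooth_on U (H a b m). Proof. exact: smooth_pderiv. Qed.
Let sdG c a b : smooth_on U (pderiv c (fun y => G y a b)).
Proof. exact: smooth_pderiv. Qed.
Let sGi a b : smooth_on U (fun y => invmx (G y) a b).
Proof. exact: smooth_invmx. Qed.

Let C i j l y := pderiv i (fun z => G z j l) y + pderiv j (fun z => G z i l) y
     - pderiv l (fun z => G z i j) y.

Let sC i j l : smooth_on U (C i j l).
Proof. by apply: smoothB => //; apply: smoothD. Qed.

Let sGC k i j l : smooth_on U (fun y => invmx (G y) k l * C i j l y).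
Proof. exact: smoothM. Qed.

Let s_chris k i j : smooth_on U (christoffel G k i j).
Proof.
by apply: smoothMl => //; apply: smooth_sum => // l _; exact: sGC.
Qed.

Let sdchris a k i j : smooth_on U (pderiv a (christoffel G k i j)).
Proof. exact: smooth_pderiv. Qed.

Let schris2 l i j k p :
  smooth_on U (fun x => christoffel G l i p x * christoffel G p j k x).
Proof. exact: smoothM. Qed.

Let s_riem l k i j : smooth_on U (riemann G l k i j).
Proof.
apply: smoothD => //; first exact: smoothB.
by apply: smooth_sum => // p _; apply: smoothB.
Qed.

Lemma smooth_ricci k j : smooth_on U (fun y => ricci G y k j).
Proof.
apply: (smooth_ext (F := fun y => \sum_i riemann G i k i j y)) => //.
  by move=> y _; rewrite mxE.
by apply: smooth_sum => // i _; exact: s_riem.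
Qed.

Lemma smooth_scalar_curvature : smooth_on U (scalar_curvature G).
Proof.
apply: smooth_sum => // i _; apply: smooth_sum => // j _.
by apply: smoothM => //; exact: smooth_ricci.
Qed.

Let GC y a b : U y -> G y a b = G y b a.
Proof. by move=> Uy; rewrite -[in LHS]symG // mxE. Qed.

Let lieG y a b : U y -> 'D_(X y) (fun z => G z a b) y
    + \sum_m (B a m y * G y m b + B b m y * G y a m) = 0.
Proof.
by move=> Uy; rewrite -(lie_derivativeE oU _ (sG a b) Uy) killG // mxE.
Qed.

(** The Killing equation [lieG] holds on all of U, so its partial derivative vanishes too. The terms
    [B c m y * pderiv m] come from commuting d_c past X. *)
Let lie_dG y c a b : U y -> 'D_(X y) (pderiv c (fun z => G z a b)) y =
  - \sum_m (B c m y * pderiv m (fun z => G z a b) y + H c a m y * G y m b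
     + B a m y * pderiv c (fun z => G z m b) y + H c b m y * G y a m
     + B b m y * pderiv c (fun z => G z a m) y).
Proof.
move=> Uy; apply/eqP; rewrite -addr_eq0; apply/eqP.
have E : pderiv c (fun y => 'D_(X y) (fun z => G z a b) y
    + \sum_m (B a m y * G y m b + B b m y * G y a m)) y = 0.
  by rewrite /pderiv (derive_ext (G := fun=> 0 : R) _ oU (fun z => @lieG z a b)) // derive_cst.
rewrite -[RHS]E {E}.
have s1 m : smooth_on U (fun y => B a m y * G y m b) by apply: smoothM.
have s2 m : smooth_on U (fun y => B b m y * G y a m) by apply: smoothM.
have s3 m : smooth_on U (fun y => B a m y * G y m b + B b m y * G y a m).
  exact: smoothD.
have s4 : smooth_on U (fun y => \sum_m (B a m y * G y m b + B b m y * G y a m)).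
  by apply: smooth_sum.
have s5 : smooth_on U (fun y => 'D_(X y) (fun z => G z a b) y).
  exact: smooth_along.
rewrite [in RHS]/pderiv (deriveD_on _ s5 s4 Uy) (derive_sum_on _ s3 Uy).
rewrite -[X in _ = X + _]/(pderiv c _ y) (pderiv_along oU c (sG a b) sX Uy).
rewrite -addrA -big_split /=; congr (_ + _); apply: eq_bigr => m _.
rewrite (deriveD_on _ (s1 m) (s2 m) Uy).
rewrite (deriveM_on _ (sB a m) (sG m b) Uy) (deriveM_on _ (sB b m) (sG a m) Uy).
by rewrite -!addrA.
Qed.

Let HC y a b m : U y -> H a b m y = H b a m y.
Proof. by move=> Uy; rewrite /H /B (pderivC oU _ _ (sX m) Uy). Qed.

Let lie_C y i j l : U y -> 'D_(X y) (C i j l) y =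
  - \sum_m (B i m y * C m j l y + B j m y * C i m l y + B l m y * C i j m y)
  - 2 * \sum_m H i j m y * G y m l.
Proof.
move=> Uy.
apply: (lie_christoffel_first (B := fun a m => B a m y)
  (C := fun i j l => C i j l y) (H := fun i j l => H i j l y) (G := G y)
  (E := fun c a b => pderiv c (fun z => G z a b) y)
  (DE := fun c a b => 'D_(X y) (pderiv c (fun z => G z a b)) y)
  (DC := fun i j l => 'D_(X y) (C i j l) y)) => {i j l}.
- by move=> a b; exact: GC.
- by move=> a b m; exact: HC.
- by move=> c a b; exact: lie_dG.
- by [].
move=> i j l; rewrite [LHS](deriveB_on _ (smoothD oU (sdG i j l) (sdG j i l)) (sdG l i j) Uy).
by rewrite (deriveD_on _ (sdG i j l) (sdG j i l) Uy).
Qed.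

Let lie_Gi_mx y : U y -> \matrix_(k, l) 'D_(X y) (fun z => invmx (G z) k l) y =
  invmx (G y) *m (\matrix_(a, m) B a m y) + (\matrix_(a, m) B a m y)^T *m invmx (G y).
Proof.
move=> Uy.
apply: (lie_inverse (G := G y) (DG := \matrix_(a, b) 'D_(X y) (fun z => G z a b) y)).
- by rewrite mulVmx ?unitG.
- by rewrite mulmxV ?unitG.
- apply/matrixP => k l; rewrite !mxE -big_split /=.
  (* An entry of invmx(G) G, hence constant on U. *)
  pose S z := \sum_m invmx (G z) k m * G z m l.
  have S0 : 'D_(X y) S y = 0.
    rewrite (derive_ext (G := fun=> (k == l)%:R : R) _ oU _ Uy); first exact: derive_cst.
    move=> z Uz; have /matrixP/(_ k l) := mulVmx (unitG Uz).
    by rewrite !mxE.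
  rewrite -[RHS]S0 (derive_sum_on (F := fun m z => invmx (G z) k m * G z m l) _ _ Uy) => [|m].
    apply: eq_bigr => m _; rewrite !mxE.
    by rewrite (deriveM_on _ (sGi k m) (sG m l) Uy).
  exact: smoothM.
apply/matrixP => a b; rewrite !mxE -[RHS](lieG a b Uy) big_split /= addrA.
by congr (_ + _ + _); apply: eq_bigr => m _; rewrite !mxE // mulrC.
Qed.

Let lie_Gi y k l : U y -> 'D_(X y) (fun z => invmx (G z) k l) y =
  \sum_m (B m k y * invmx (G y) m l + B m l y * invmx (G y) k m).
Proof.
move=> Uy; have /matrixP/(_ k l) := lie_Gi_mx Uy.
rewrite !mxE => ->; rewrite -big_split; apply: eq_bigr => m _ /=.
by rewrite !mxE addrC [_ * B m l y]mulrC.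
Qed.

Let lie_chris y k i j : U y -> 'D_(X y) (christoffel G k i j) y =
  - H i j k y + \sum_m (B m k y * christoffel G m i j y
     - B i m y * christoffel G k m j y - B j m y * christoffel G k i m y).
Proof.
move=> Uy.
apply: (lie_christoffel_second (B := fun a m => B a m y) (Gi := invmx (G y))
  (C := fun i j l => C i j l y) (H := fun i j l => H i j l y) (G := G y)
  (DGi := fun k l => 'D_(X y) (fun z => invmx (G z) k l) y)
  (DC := fun i j l => 'D_(X y) (C i j l) y)
  (Gam := fun k i j => christoffel G k i j y)
  (DGam := fun k i j => 'D_(X y) (christoffel G k i j) y)) => {k i j}.
- by rewrite pnatr_eq0.
- by move=> a b; exact: GC.
- by rewrite mulVmx ?unitG.
- by move=> k l; exact: lie_Gi.
- by move=> i j l; exact: lie_C.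
- by [].
move=> k i j.
have sS : smooth_on U (fun y => \sum_l invmx (G y) k l * C i j l y).
  by apply: smooth_sum => // l _; exact: sGC.
rewrite [LHS](deriveMl_on _ _ sS Uy) (derive_sum_on _ (sGC k i j) Uy).
congr (_ * _); apply: eq_bigr => l _.
by rewrite (deriveM_on _ (sGi k l) (sC i j l) Uy).
Qed.

Let sBch a m k i j : smooth_on U (fun y => B a m y * christoffel G k i j y).
Proof. exact: smoothM. Qed.

(** The formula [lie_chris] is differentiated on U in the direction d_a; the last sum is again the
    commutator correction. *)
Let lie_dchris y a k i j : U y ->
  'D_(X y) (pderiv a (christoffel G k i j)) y = - pderiv a (H i j k) y
  + \sum_m (H a m k y * christoffel G m i j y
      + B m k y * pderiv a (christoffel G m i j) y
      - (H a i m y * christoffel G k m j y + B i m y * pderiv a (christoffel G k m j) y)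
      - (H a j m y * christoffel G k i m y + B j m y * pderiv a (christoffel G k i m) y))
  - \sum_m B a m y * pderiv m (christoffel G k i j) y.
Proof.
move=> Uy; apply/eqP; rewrite eq_sym subr_eq; apply/eqP.
rewrite -(pderiv_along oU a (s_chris k i j) sX Uy).
rewrite [RHS](derive_ext _ oU (fun z => @lie_chris z k i j) Uy).
have s1 m : smooth_on U (fun y => B m k y * christoffel G m i j y
    - B i m y * christoffel G k m j y) by apply: smoothB.
have s2 m : smooth_on U (fun y => B m k y * christoffel G m i j y
    - B i m y * christoffel G k m j y - B j m y * christoffel G k i m y).
  exact: smoothB.
have s3 : smooth_on U (fun y => \sum_m (B m k y * christoffel G m i j y
    - B i m y * christoffel G k m j y - B j m y * christoffel G k i m y)).
  by apply: smooth_sum => // m _.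
rewrite (deriveD_on _ (smoothN oU (sH i j k)) s3 Uy) (deriveN_on _ (sH i j k) Uy).
congr (_ + _); rewrite (derive_sum_on _ s2 Uy); apply: eq_bigr => m _.
rewrite (deriveB_on _ (s1 m) (sBch j m k i m) Uy).
rewrite (deriveB_on _ (sBch m k m i j) (sBch i m k m j) Uy).
by rewrite !(deriveM_on _ (sB _ _) (s_chris _ _ _) Uy).
Qed.

Let lie_riem y l k i j : U y -> 'D_(X y) (riemann G l k i j) y =
  \sum_m (B m l y * riemann G m k i j y - B k m y * riemann G l m i j y
           - B i m y * riemann G l k m j y - B j m y * riemann G l k i m y).
Proof.
move=> Uy.
apply: (lie_riemann (B := fun a m => B a m y) (H := fun i j l => H i j l y)
  (H3 := fun a b c m => pderiv a (H b c m) y)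
  (C := fun k i j => christoffel G k i j y)
  (DC := fun k i j => 'D_(X y) (christoffel G k i j) y)
  (dC := fun a k i j => pderiv a (christoffel G k i j) y)
  (DdC := fun a k i j => 'D_(X y) (pderiv a (christoffel G k i j)) y)
  (Rm := fun l k i j => riemann G l k i j y)
  (DRm := fun l k i j => 'D_(X y) (riemann G l k i j) y)) => {l k i j}.
- by move=> a b m; exact: HC.
- by move=> a b c m; rewrite /H (pderivC oU _ _ (sB c m) Uy).
- by move=> k i j; exact: lie_chris.
- by move=> a k i j; exact: lie_dchris.
- by [].
move=> l k i j.
have s1 p : smooth_on U (fun y => christoffel G l i p y * christoffel G p j k y
    - christoffel G l j p y * christoffel G p i k y) by apply: smoothB.
have s2 : smooth_on U (fun y => \sum_p (christoffel G l i p y * christoffel G p j k y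
    - christoffel G l j p y * christoffel G p i k y)) by apply: smooth_sum.
rewrite [LHS](deriveD_on _ (smoothB oU (sdchris i l j k) (sdchris j l i k)) s2 Uy).
rewrite (deriveB_on _ (sdchris i l j k) (sdchris j l i k) Uy); congr (_ + _).
rewrite (derive_sum_on _ s1 Uy); apply: eq_bigr => p _.
rewrite (deriveB_on _ (schris2 l i j k p) (schris2 l j i k p) Uy).
by rewrite !(deriveM_on _ (s_chris _ _ _) (s_chris _ _ _) Uy).
Qed.

Let lie_ricci_entry y k j : U y -> 'D_(X y) (fun z => ricci G z k j) y =
  - \sum_m (B k m y * ricci G y m j + B j m y * ricci G y k m).
Proof.
move=> Uy.
apply: (lie_contract (B := fun a m => B a m y)
  (Rm := fun l k i j => riemann G l k i j y)
  (DRm := fun l k i j => 'D_(X y) (riemann G l k i j) y)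
  (Rc := ricci G y)
  (DRc := fun k j => 'D_(X y) (fun z => ricci G z k j) y)) => {k j}.
- by move=> l k i j; exact: lie_riem.
- by move=> k j; rewrite mxE.
move=> k j; rewrite -(derive_sum_on _ (fun i => s_riem i k i j) Uy).
by congr ('D_(X y) _ y); apply/funext => z; rewrite mxE.
Qed.

Lemma lie_derivative_ricci y : U y -> lie_derivative X (ricci G) y = 0.
Proof.
move=> Uy; apply/matrixP => a b.
rewrite (lie_derivativeE oU _ (smooth_ricci a b) Uy) lie_ricci_entry // mxE.
by rewrite addrC subrr.
Qed.

Lemma derive_scalar_curvature y : U y -> 'D_(X y) (scalar_curvature G) y = 0.
Proof.
move=> Uy.
have s1 i j : smooth_on U (fun y => invmx (G y) i j * ricci G y i j).
  by apply: smoothM => //; exact: smooth_ricci.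
rewrite (derive_sum_on (F := fun i y => \sum_j invmx (G y) i j * ricci G y i j) _ _ Uy);
  last by move=> i; apply: smooth_sum.
pose DRc := \matrix_(k, j) 'D_(X y) (fun z => ricci G z k j) y.
have E : DRc + (\matrix_(a, m) B a m y) *m ricci G y
    + ricci G y *m (\matrix_(a, m) B a m y)^T = 0.
  apply/matrixP => a b; rewrite !mxE lie_ricci_entry // big_split /= -addrA.
  apply/eqP; rewrite addrC subr_eq0; apply/eqP.
  by congr (_ + _); apply: eq_bigr => m _; rewrite !mxE // mulrC.
rewrite -[RHS](lie_trace (lie_Gi_mx Uy) E) /mxtrace -big_split /=.
apply: eq_bigr => i _; rewrite (derive_sum_on _ (s1 i) Uy) !mxE -big_split /=.
apply: eq_bigr => j _; rewrite (deriveM_on _ (sGi i j) (smooth_ricci i j) Uy).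
by rewrite !mxE.
Qed.

End LieNatural.

(** * Product coordinates *)

(** Naming the entry map allows it to carry a linear structure, as [smooth_postcomp] and
    [derive_precomp] require. *)
Definition mx_entry (R : realType) m n (i : 'I_m) (j : 'I_n) (K : 'M[R]_(m, n)) : R :=
  K i j.

Lemma mx_entry_is_linear (R : realType) m n (i : 'I_m) (j : 'I_n) :
  linear (@mx_entry R m n i j).
Proof. by move=> a u v; rewrite /mx_entry !mxE. Qed.

HB.instance Definition _ (R : realType) m n (i : 'I_m) (j : 'I_n) :=
  GRing.isLinear.Build R 'M[R]_(m, n) R *:%R (@mx_entry R m n i j)
    (@mx_entry_is_linear R m n i j).

Lemma mx_entry_continuous (R : realType) m n (i : 'I_m) (j : 'I_n) :
  continuous (@mx_entry R m n i j).
Proof. exact: coord_continuous. Qed.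

(** Scaling viewed as a linear map of the scalar: it rebuilds a smooth row vector from its smooth
    components. *)
Definition scale_vec (R : realType) (W : normedModType R) (w : W) (c : R) : W :=
  c *: w.

Lemma scale_vec_is_linear (R : realType) (W : normedModType R) (w : W) :
  linear (scale_vec w).
Proof. by move=> a u v; rewrite /scale_vec scalerDl scalerA. Qed.

HB.instance Definition _ (R : realType) (W : normedModType R) (w : W) :=
  GRing.isLinear.Build R R W *:%R (scale_vec w) (scale_vec_is_linear w).

Section Entries.
Context {R : realType} {V : normedModType R} (U : set V) (oU : open U).

Lemma smooth_entry m n (K : V -> 'M[R]_(m, n)) i j : smooth_on U K ->
  smooth_on U (fun y => K y i j).
Proof. exact: (smooth_postcomp (@mx_entry_continuous R m n i j) oU). Qed.

Lemma smooth_row n (X : V -> 'rV[R]_n) :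
  (forall j, smooth_on U (fun y => X y 0 j)) -> smooth_on U X.
Proof.
move=> sX.
apply: (smooth_ext (F := fun y => \sum_j scale_vec (delta_mx 0 j) (X y 0 j))) => //.
  by move=> y _; rewrite [RHS]row_sum_delta.
apply: smooth_sum => // j _.
by apply: (smooth_postcomp _ oU (sX j)); exact: scalel_continuous.
Qed.

End Entries.

Section Log.
Context {R : realType} {V : normedModType R}.

Lemma derive_ln (F : V -> R) x v : derivable F x v -> 0 < F x ->
  'D_v (fun y => ln (F y)) x = (F x)^-1 * 'D_v F x.
Proof.
move=> /derivable1P dF Fx.
rewrite -[v in LHS]scale1r -[v in RHS]scale1r !derive_line -!derive1E.
have F0 : F (0 *: v + x) = F x by rewrite scale0r add0r.
have [dl El] := is_derive1_ln Fx.
have dl' : derivable (@ln R) (F (0 *: v + x)) 1 by rewrite F0.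
rewrite [LHS](derive1_comp dF dl').
by rewrite F0 derive1E El.
Qed.

End Log.

Section ProductCoordinates.
Context {R : realType} {n : nat}.

(** With both projections declared linear, a function of t alone or of x alone is a composite with a
    linear map, and its derivatives reduce to those on the factor. *)
Definition time_coord : 'rV[R]_(1 + n) -> R := mx_entry 0 0 \o lsubmx.
Definition space_coord : 'rV[R]_(1 + n) -> 'rV[R]_n := rsubmx.

HB.instance Definition _ := GRing.Linear.on time_coord.
HB.instance Definition _ := GRing.Linear.on space_coord.

Lemma time_coord_continuous : continuous time_coord.
Proof.
move=> y; apply: continuous_comp; last exact: mx_entry_continuous.
exact: continuous_lsubmx.
Qed.

Lemma space_coord_continuous : continuous space_coord.
Proof. exact: continuous_rsubmx. Qed.

Lemma time_coord_row a (b : 'rV[R]_n) : time_coord (row_mx (const_mx a) b) = a.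
Proof. by rewrite /time_coord /= row_mxKl /mx_entry mxE. Qed.

Lemma space_coord_row a (b : 'rV[R]_n) :
  space_coord (row_mx (const_mx a) b) = b.
Proof. exact: row_mxKr. Qed.

Lemma time_space_coord y : row_mx (const_mx (time_coord y)) (space_coord y) = y.
Proof.
rewrite -[RHS]hsubmxK; congr row_mx; apply/rowP => j.
by rewrite !ord1 mxE.
Qed.

Lemma time_coord_dt (a : 'I_1) : time_coord (delta_mx 0 (lshift n a)) = 1.
Proof. by rewrite /time_coord /= /mx_entry !mxE !ord1. Qed.

Lemma space_coord_dt (a : 'I_1) : space_coord (delta_mx 0 (lshift n a)) = 0.
Proof. by apply/rowP => j; rewrite !mxE eq_rlshift andbF. Qed.

Lemma time_coord_dx (a : 'I_n) : time_coord (delta_mx 0 (rshift 1 a)) = 0.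
Proof. by rewrite /time_coord /= /mx_entry !mxE eq_lrshift andbF. Qed.

Lemma space_coord_dx (a : 'I_n) :
  space_coord (delta_mx 0 (rshift 1 a)) = delta_mx 0 a.
Proof. by apply/rowP => j; rewrite !mxE eq_rshift. Qed.

Variables (I : set R) (S : set 'rV[R]_n).

Definition cylinder : set 'rV[R]_(1 + n) :=
  [set y | I (time_coord y) /\ S (space_coord y)].

Lemma open_cylinder : open I -> open S -> open cylinder.
Proof.
move=> oI oS; apply: openI.
  by apply: open_comp => // y _; exact: time_coord_continuous.
by apply: open_comp => // y _; exact: space_coord_continuous.
Qed.

Lemma smooth_time (W : normedModType R) (h : R -> W) :
  smooth_on I h -> smooth_on cylinder (h \o time_coord).
Proof.
by move=> sh; apply: smooth_subset (smooth_precomp time_coord_continuous sh) => y [].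
Qed.

Lemma smooth_space (W : normedModType R) (F : 'rV[R]_n -> W) :
  smooth_on S F -> smooth_on cylinder (F \o space_coord).
Proof.
by move=> sF; apply: smooth_subset (smooth_precomp space_coord_continuous sF) => y [].
Qed.

Lemma derive_time (W : normedModType R) (h : R -> W) v y :
  'D_v (h \o time_coord) y = 'D_(time_coord v) h (time_coord y).
Proof. exact: derive_precomp. Qed.

Lemma derive_space (W : normedModType R) (F : 'rV[R]_n -> W) v y :
  'D_v (F \o space_coord) y = 'D_(space_coord v) F (space_coord y).
Proof. exact: derive_precomp. Qed.

Lemma derive_scale1 (h : R -> R) t c : smooth_on I h -> I t ->
  'D_c h t = c * derive1 h t.
Proof.
move=> sh It; rewrite derive1E -deriveZv ?[c *: 1]mulr1 //.
exact: smooth_derivable sh It.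
Qed.

End ProductCoordinates.

(** * Charts, transitions and lifted vector fields on the product *)

Section ProductAtlas.
Context {R : realType} {n : nat} {M : topologicalType}.
Variables (A : atlas R n M) (I : set R).

Lemma cimg_prod (i : A) :
  cimg (A := prod_atlas I A) i = cylinder I (cimg i).
Proof.
apply/seteqP; split => [_ [[t p] [/= It dp] <-]|y [It [p dp E]]].
  by split; rewrite ?time_coord_row ?space_coord_row //; exists p.
exists (time_coord y, p); first by split.
by rewrite /= E time_space_coord.
Qed.

Lemma overlap_prod (i j : A) :
  overlap (A := prod_atlas I A) i j = cylinder I (overlap i j).
Proof.
apply/seteqP; split => [_ [[t p] [[/= It dp] [/= _ dpj]] <-]|y [It [p [dp dpj] E]]].
  by split; rewrite ?time_coord_row ?space_coord_row //; exists p.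
exists (time_coord y, p); first by split; split.
by rewrite /= E time_space_coord.
Qed.

Lemma transition_prod (i j : A) y :
  transition (A := prod_atlas I A) i j y =
  row_mx (const_mx (time_coord y)) (transition i j (space_coord y)).
Proof. by []. Qed.

Lemma derive_transition_prod (i j : A) y v : smooth_atlas A setT ->
  overlap i j (space_coord y) ->
  'D_v (transition (A := prod_atlas I A) i j) y =
  row_mx (const_mx (time_coord v))
    ('D_(space_coord v) (transition i j) (space_coord y)).
Proof.
move=> [_ _ _ _ /(_ i j) sT] oy.
have dT : derivable (transition i j) (space_coord y) (space_coord v).
  exact: smooth_derivable sT oy.
pose tau := transition (A := prod_atlas I A) i j.
have tl k : (fun z => tau z 0 (lshift n k)) = id \o time_coord.
  by apply/funext => z; rewrite /tau transition_prod row_mxEl mxE.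
have tr k : (fun z => tau z 0 (rshift 1 k)) =
    (fun x => transition i j x 0 k) \o space_coord.
  by apply/funext => z; rewrite /tau transition_prod row_mxEr.
(* Entry by entry: the time entry is the identity of t, the others are those of the transition of
   A. *)
have dtau : derivable tau y v.
  apply/derivable_mxP => a k; rewrite ord1.
  case: (split_ordP k) => k' ->.
    by rewrite tl; apply: derivable_precomp; exact: derivable_id.
  by rewrite tr; apply: derivable_precomp; move/derivable_mxP : dT; exact.
rewrite -/tau derive_mx // (derive_mx dT); apply/rowP => k; rewrite mxE.
case: (split_ordP k) => k' ->.
  by rewrite tl derive_time derive_id row_mxEl mxE.
by rewrite tr derive_space row_mxEr mxE.
Qed.

Variables (h : R -> R) (zeta : vfield A).
Let X := add_vfield (lift_time (I := I) h) (lift_space (I := I) zeta).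

Lemma add_lift (i : A) y :
  X i y = row_mx (const_mx (h (time_coord y))) (zeta i (space_coord y)).
Proof. by rewrite /X /add_vfield add_row_mx addr0 add0r. Qed.

Lemma add_lift_time (i : A) a : (fun y => X i y 0 (lshift n a)) = h \o time_coord.
Proof. by apply/funext => y; rewrite add_lift row_mxEl mxE. Qed.

Lemma add_lift_space (i : A) a :
  (fun y => X i y 0 (rshift 1 a)) = (fun x => zeta i x 0 a) \o space_coord.
Proof. by apply/funext => y; rewrite add_lift row_mxEr. Qed.

Hypothesis smA : smooth_atlas A setT.
Hypothesis oI : open I.
Hypothesis sh : smooth_on I h.
Hypothesis vz : vector_field zeta.

Let o_cimg (i : A) : open (cimg i).
Proof. by case: smA => _ /(_ i)[]. Qed.

Let oU (i : A) : open (cylinder I (cimg i)).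
Proof. exact: open_cylinder. Qed.

Lemma smooth_add_lift (i : A) a : smooth_on (cylinder I (cimg i)) (fun y => X i y 0 a).
Proof.
case: (split_ordP a) => a' ->; first by rewrite add_lift_time; exact: smooth_time.
rewrite add_lift_space; apply: smooth_space; apply: smooth_entry => //.
by case: vz.
Qed.

Lemma vector_field_add_lift : vector_field X.
Proof.
split=> [i|i j y].
  by rewrite cimg_prod; apply: smooth_row => // a; exact: smooth_add_lift.
rewrite overlap_prod => -[It oy].
rewrite (derive_transition_prod _ _ oy) // transition_prod !add_lift.
by rewrite !time_coord_row !space_coord_row; case: vz => _ ->.
Qed.

End ProductAtlas.

(** * The doubly warped metric *)

(** A nonzero v with v K = 0 would make the quadratic form vanish at v. *)
Lemma posdef_unitmx (R : realFieldType) n (K : 'M[R]_n) :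
  (forall v : 'rV[R]_n, v != 0 -> 0 < (v *m K *m v^T) 0 0) -> K \in unitmx.
Proof.
move=> Kpos; rewrite unitmxE unitfE; apply/negP => /det0P[v v0 vK].
by have := Kpos v v0; rewrite vK mul0mx mxE ltxx.
Qed.

Section Warped.
Context {R : realType} {n : nat} {M : topologicalType}.
Variables (A : atlas R n M) (g : tensor2 A) (I : set R).
Variables (f : M -> R) (sigma h : R -> R) (zeta : vfield A).
Hypothesis smA : smooth_atlas A setT.
Hypothesis rg : riemannian_metric g.
Hypothesis oI : open I.
Hypothesis sf : smooth_function A f.
Hypothesis f0 : forall p, 0 < f p.
Hypothesis ss : smooth_on I sigma.
Hypothesis s0 : forall t, I t -> 0 < sigma t.
Hypothesis sh : smooth_on I h.
Hypothesis vz : vector_field zeta.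

Let G : tensor2 (prod_atlas I A) := doubly_warped f sigma g.
Let X := add_vfield (lift_time (I := I) h) (lift_space (I := I) zeta).

Variable i : A.
Let U := cylinder I (cimg i).
Let fi : 'rV[R]_n -> R := f \o cinv i.

Let o_cimg : open (cimg i).
Proof. by case: smA => _ /(_ i)[]. Qed.

Let oU : open U.
Proof. exact: open_cylinder. Qed.

Let warpE y : G i y = block_mx (const_mx (- fi (space_coord y) ^+ 2)) 0
  0 (sigma (time_coord y) ^+ 2 *: g i (space_coord y)).
Proof. by []. Qed.

Let warp_tt a b : (fun y => G i y (lshift n a) (lshift n b)) =
  (fun x => - fi x ^+ 2) \o space_coord.
Proof. by apply/funext => y; rewrite warpE block_mxEul mxE. Qed.

Let warp_tx a b : (fun y => G i y (lshift n a) (rshift 1 b)) = fun=> 0.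
Proof. by apply/funext => y; rewrite warpE block_mxEur mxE. Qed.

Let warp_xt a b : (fun y => G i y (rshift 1 a) (lshift n b)) = fun=> 0.
Proof. by apply/funext => y; rewrite warpE block_mxEdl mxE. Qed.

(** The product of a function of t and a function of x, with the square expanded, is the form to
    which the product rule applies. *)
Let warp_xx a b : (fun y => G i y (rshift 1 a) (rshift 1 b)) =
  fun y => ((fun t => sigma t * sigma t) \o time_coord) y *
           ((fun x => g i x a b) \o space_coord) y.
Proof. by apply/funext => y; rewrite warpE block_mxEdr mxE expr2. Qed.

Let s_g a b : smooth_on (cimg i) (fun x => g i x a b).
Proof. by apply: smooth_entry => //; case: rg => -[sg _ _ _]; exact: sg. Qed.

Let s_fi : smooth_on (cimg i) fi. Proof. exact: sf. Qed.

Let s_f2 : smooth_on (cimg i) (fun x => - fi x ^+ 2).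
Proof. by apply: smoothN => //; apply: smoothM. Qed.

Let s_s2 : smooth_on I (fun t => sigma t * sigma t).
Proof. exact: smoothM. Qed.

Lemma smooth_warped a b : smooth_on U (fun y => G i y a b).
Proof.
case: (split_ordP a) => a' ->; case: (split_ordP b) => b' ->.
- by rewrite warp_tt; exact: smooth_space.
- by rewrite warp_tx; exact: smooth_cst.
- by rewrite warp_xt; exact: smooth_cst.
by rewrite warp_xx; apply: smoothM => //; [exact: smooth_time|exact: smooth_space].
Qed.

Lemma warped_sym y : U y -> (G i y)^T = G i y.
Proof.
move=> [It Sx]; case: rg => _ symg _.
rewrite warpE tr_block_mx !trmx0; congr block_mx; apply/matrixP => a b.
  by rewrite !mxE.
by have /matrixP/(_ a b) := symg i _ Sx; rewrite !mxE => ->.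
Qed.

(** The determinant is - f^2 (sigma^2)^n det g, and every factor is nonzero. *)
Lemma warped_unit y : U y -> G i y \in unitmx.
Proof.
move=> [It Sx]; case: rg => _ _ posg.
rewrite warpE unitmxE det_ublock det_mx11 detZ mxE unitfE !mulf_neq0 //.
- by rewrite oppr_eq0 expf_neq0 // gt_eqF // f0.
- by rewrite expf_neq0 // expf_neq0 // gt_eqF // s0.
by rewrite -unitfE -unitmxE posdef_unitmx //; exact: posg.
Qed.

(** [time_eq] is the time block of L_X G = 0 divided by -2 f, and [space_eq] the space block divided
    by sigma^2. *)
Hypothesis time_eq : forall t, I t -> forall x, cimg i x ->
  fi x * derive1 h t + vf_apply zeta f i x = 0.
Hypothesis space_eq : forall t, I t -> forall x, cimg i x ->
  lie_derivative (zeta i) (g i) x = - (2 * h t * derive1 sigma t / sigma t) *: g i x.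

Let s_X a : smooth_on U (fun y => X i y 0 a).
Proof. exact: smooth_add_lift. Qed.

Let time_X y : time_coord (X i y) = h (time_coord y).
Proof. by rewrite /X add_lift time_coord_row. Qed.

Let space_X y : space_coord (X i y) = zeta i (space_coord y).
Proof. by rewrite /X add_lift space_coord_row. Qed.

Let d_tt a b y :
  pderiv (lshift n a) (fun y => X i y 0 (lshift n b)) y = derive1 h (time_coord y).
Proof.
by rewrite /pderiv /X add_lift_time derive_time time_coord_dt derive1E.
Qed.

Let d_tx a b y : pderiv (lshift n a) (fun y => X i y 0 (rshift 1 b)) y = 0.
Proof. by rewrite /pderiv /X add_lift_space derive_space space_coord_dt derive0. Qed.

Let d_xt a b y : pderiv (rshift 1 a) (fun y => X i y 0 (lshift n b)) y = 0.
Proof. by rewrite /pderiv /X add_lift_time derive_time time_coord_dx derive0. Qed.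

Let d_xx a b y : pderiv (rshift 1 a) (fun y => X i y 0 (rshift 1 b)) y =
  pderiv a (fun x => zeta i x 0 b) (space_coord y).
Proof. by rewrite /pderiv /X add_lift_space derive_space space_coord_dx. Qed.

Let wtt a b y : G i y (lshift n a) (lshift n b) = - fi (space_coord y) ^+ 2.
Proof. by rewrite warpE block_mxEul mxE. Qed.
Let wtx a b y : G i y (lshift n a) (rshift 1 b) = 0.
Proof. by rewrite warpE block_mxEur mxE. Qed.
Let wxt a b y : G i y (rshift 1 a) (lshift n b) = 0.
Proof. by rewrite warpE block_mxEdl mxE. Qed.
Let wxx a b y : G i y (rshift 1 a) (rshift 1 b) =
  sigma (time_coord y) ^+ 2 * g i (space_coord y) a b.
Proof. by rewrite warpE block_mxEdr mxE. Qed.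

(** The mixed blocks vanish because h depends on t alone and zeta on x alone. The time block is -2 f
    (f h' + zeta(f)), and the space block is 2 h sigma sigma' g + sigma^2 L_zeta g. *)
Lemma lie_warped y : U y -> lie_derivative (X i) (G i) y = 0.
Proof.
move=> Uy; have [It Sx] := Uy; apply/matrixP => a b.
rewrite (lie_derivativeE oU _ (smooth_warped a b) Uy) [RHS]mxE.
rewrite big_split_ord big_ord1 /=.
set t := time_coord y; set x := space_coord y.
case: (split_ordP a) => a' ->; case: (split_ordP b) => b' ->.
- rewrite big1 => [|m _]; last by rewrite !d_tx !mul0r addr0.
  rewrite !d_tt !wtt warp_tt derive_space space_X -/x -/t.
  have -> : 'D_(zeta i x) (fun x => - fi x ^+ 2) x = - 2 * fi x * vf_apply zeta f i x.
    rewrite (deriveN_on (F := fun x => fi x * fi x) _ (smoothM o_cimg s_fi s_fi) Sx).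
    rewrite (deriveM_on _ s_fi s_fi Sx).
    rewrite /vf_apply -/fi; move: ('D_ _ _ _) => D; ring.
  have := time_eq It Sx; rewrite -/t -/x.
  move: (derive1 h t) (vf_apply _ _ _ _) (fi x) => dh v F E.
  transitivity (- 2 * F * (F * dh + v)); [ring|by rewrite E mulr0].
- rewrite big1 => [|m _]; last by rewrite !d_tx !wtx !mul0r mulr0 addr0.
  rewrite warp_tx d_xt !wtx mulr0 mul0r !addr0; exact: derive_cst.
- rewrite big1 => [|m _]; last by rewrite !d_tx !wxt !mul0r mulr0 addr0.
  rewrite warp_xt d_xt !wxt mulr0 mul0r !addr0; exact: derive_cst.
rewrite !d_xt !mul0r !add0r warp_xx.
have sc1 : smooth_on U ((fun t => sigma t * sigma t) \o time_coord) by exact: smooth_time.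
have sc2 : smooth_on U ((fun x => g i x a' b') \o space_coord) by exact: smooth_space.
rewrite (deriveM_on _ sc1 sc2 Uy) derive_time derive_space time_X space_X -/t -/x /=.
rewrite (deriveM_on _ ss ss It) (derive_scale1 _ ss It).
have := space_eq It Sx => /matrixP/(_ a' b').
rewrite (lie_derivativeE o_cimg _ (s_g a' b') Sx) mxE -/x -/t.
(* With sigma^2 factored out, what is left is the algebraic part of L_zeta g. *)
have -> : \sum_m (pderiv (rshift 1 a') (fun y => X i y 0 (rshift 1 m)) y
      * G i y (rshift 1 m) (rshift 1 b')
    + pderiv (rshift 1 b') (fun y => X i y 0 (rshift 1 m)) y
      * G i y (rshift 1 a') (rshift 1 m)) =
  sigma t ^+ 2 * \sum_m (pderiv a' (fun x => zeta i x 0 m) x * g i x m b'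
    + pderiv b' (fun x => zeta i x 0 m) x * g i x a' m).
  rewrite mulr_sumr; apply: eq_bigr => m _.
  by rewrite !d_xx !wxx -/x -/t mulrCA [X in _ + X]mulrCA -mulrDr.
move: ('D_ _ _ _) (\sum_m _) (g i x a' b') (derive1 sigma t) (h t) => D S gab ds ht E.
have st0 : sigma t != 0 by rewrite gt_eqF // s0.
have -> : D = - (2 * ht * ds / sigma t) * gab - S by rewrite -E addrK.
by field.
Qed.

Variables (kappa lambda : R) (T : tensor2 (prod_atlas I A)).
Hypothesis kappa0 : kappa != 0.
Hypothesis einT : einstein_equation G kappa lambda T.

Lemma lie_energy_momentum y : U y -> lie_derivative (X i) (T i) y = 0.
Proof.
move=> Uy.
have sRc := smooth_ricci oU smooth_warped warped_unit.
have sr := smooth_scalar_curvature oU smooth_warped warped_unit.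
have dRc := lie_derivative_ricci oU s_X smooth_warped warped_sym warped_unit lie_warped Uy.
have dr := derive_scalar_curvature oU s_X smooth_warped warped_sym warped_unit lie_warped Uy.
have dG := lie_warped Uy.
pose r := scalar_curvature (G i).
(* The field equation solved for T. It holds on the open set U only, so derivatives of T are
   exchanged for those of F by [derive_ext]. *)
pose F a b y := kappa^-1 * (ricci (G i) y a b - 2^-1 * (r y * G i y a b)
    + lambda * G i y a b).
have TE z a b : U z -> F a b z = T i z a b.
  move=> Uz; have := einT (i := i) (x := z); rewrite cimg_prod => /(_ Uz).
  rewrite /F /r.
  move: (ricci _ _) (scalar_curvature _ _) (G i z) (T i z) => P q K L /matrixP/(_ a b).
  rewrite !mxE => E; apply: (mulfI kappa0); rewrite mulVKf //.
  by rewrite -[RHS](subrK (lambda * K a b)) -E; ring.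
have srG a b : smooth_on U (fun y => r y * G i y a b).
  by apply: smoothM => //; exact: smooth_warped.
have sF1 a b : smooth_on U (fun y => ricci (G i) y a b - 2^-1 * (r y * G i y a b)).
  by apply: smoothB => //; apply: smoothMl.
have slG a b : smooth_on U (fun y => lambda * G i y a b).
  by apply: smoothMl => //; exact: smooth_warped.
have sF2 a b : smooth_on U (fun y => ricci (G i) y a b - 2^-1 * (r y * G i y a b)
    + lambda * G i y a b) by apply: smoothD.
have sF a b : smooth_on U (F a b) by apply: smoothMl.
have sT a b : smooth_on U (fun y => T i y a b).
  by apply: smooth_ext (sF a b) => // z Uz; exact: TE.
apply/matrixP => a b; rewrite [RHS]mxE.
rewrite (lie_derivativeE oU _ (sT a b) Uy).
have <- : 'D_(X i y) (F a b) y = 'D_(X i y) (fun z => T i z a b) y.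
  by apply: derive_ext oU _ Uy => z Uz; exact: TE.
rewrite (deriveMl_on _ _ (sF2 a b) Uy) (deriveD_on _ (sF1 a b) (slG a b) Uy).
rewrite (deriveB_on _ (sRc a b) (smoothMl _ _ (srG a b)) Uy) //.
rewrite !(deriveMl_on _ _ _ Uy) //; last exact: smooth_warped.
rewrite (deriveM_on _ sr (smooth_warped a b) Uy) dr mul0r add0r.
(* The algebraic part of the Lie derivative, linear in K. With X(r) = 0, the claim becomes the same
   linear combination of L_X Ric = 0 and L_X G = 0. *)
pose L (K : 'M[R]_(1 + n)) := \sum_m
  (pderiv a (fun y => X i y 0 m) y * K m b + pderiv b (fun y => X i y 0 m) y * K a m).
have -> : \sum_m (pderiv a (fun y => X i y 0 m) y * T i y m b
  + pderiv b (fun y => X i y 0 m) y * T i y a m) =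
  kappa^-1 * (L (ricci (G i) y) - 2^-1 * (r y * L (G i y)) + lambda * L (G i y)).
  rewrite /L !mulr_sumr -sumrB -big_split mulr_sumr; apply: eq_bigr => m _ /=.
  rewrite -!TE // /F; move: (pderiv _ _ _) (pderiv _ _ _) => p q.
  by move: (ricci _ _ _ _) (ricci _ _ _ _) (r y) (G _ _ _ _) (G _ _ _ _) => *; ring.
move/matrixP/(_ a b): dRc; rewrite (lie_derivativeE oU _ (sRc a b) Uy) mxE -/(L _).
move/matrixP/(_ a b): dG; rewrite (lie_derivativeE oU _ (smooth_warped a b) Uy) mxE -/(L _).
rewrite -/r.
move: (L _) (L _) ('D_ _ _ _) ('D_ _ _ _) (r y) => l1 l2 d1 d2 rr E2 E1.
have -> : d2 = - l2 by apply/eqP; rewrite -addr_eq0 E2.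
have -> : d1 = - l1 by apply/eqP; rewrite -addr_eq0 E1.
ring.
Qed.

End Warped.

(** * The zero field and the three collineations *)

Lemma vector_field0 (R : realType) (n : nat) (M : topologicalType)
    (A : atlas R n M) : vector_field (fun (_ : A) _ => 0).
Proof.
split=> [i|i j x _]; first exact: smooth_cst.
by rewrite derive0.
Qed.

Lemma lie_derivative0 (R : realType) (n : nat) (K : 'rV[R]_n -> 'M[R]_n) x :
  lie_derivative (fun=> 0) K x = 0.
Proof.
apply/matrixP => a b; rewrite !mxE big1 // => m _.
have d c : pderiv c (fun y : 'rV[R]_n => (0 : 'rV[R]_n) 0 m) x = 0 by exact: derive_cst.
by rewrite !d mxE !mul0r !addr0.
Qed.

Theorem corollary2 (R : realType) (n : nat) (M : topologicalType)
  (A : atlas R n M) (g : tensor2 A) (I : set R)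
  (f : M -> R) (sigma : R -> R) (h : R -> R) (zeta : vfield A)
  (kappa lambda : R) (T : tensor2 (prod_atlas I A)) :
  smooth_manifold A -> riemannian_metric g ->
  open I -> is_interval I ->
  smooth_function A f -> (forall p, 0 < f p) ->
  smooth_on I sigma -> (forall t, I t -> 0 < sigma t) ->
  smooth_on I h -> vector_field zeta ->
  tensor_field T -> kappa != 0 ->
  einstein_equation (doubly_warped f sigma g) kappa lambda T ->
  [/\ (forall t, I t -> derive1 h t = 0 /\ derive1 sigma t = 0) ->
        matter_collineation T (lift_time h),
      killing g zeta ->
      (forall i x, cimg i x -> vf_apply zeta f i x = 0) ->
        matter_collineation T (lift_space zeta)
    & (forall t, I t -> forall i x, cimg i x ->
         derive1 h t = - vf_apply zeta (fun p => ln (f p)) i x) ->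
      (forall t, I t ->
         conformal g zeta (fun=> - (2 * h t * derive1 sigma t / sigma t))) ->
        matter_collineation T (add_vfield (lift_time h) (lift_space zeta))].
Proof.
move=> [_ _ smA] rg oI _ sf f0 ss s0 sh vz _ k0 einT.
have main (k : R -> R) (xi : vfield A) : smooth_on I k -> vector_field xi ->
    (forall i t x, I t -> cimg i x ->
       f (cinv i x) * derive1 k t + vf_apply xi f i x = 0 /\
       lie_derivative (xi i) (g i) x =
         - (2 * k t * derive1 sigma t / sigma t) *: g i x) ->
    matter_collineation T (add_vfield (lift_time k) (lift_space xi)).
  move=> sk vxi eqs; split; first exact: vector_field_add_lift.
  move=> i y; rewrite cimg_prod => Uy.
  apply: (lie_energy_momentum smA rg oI sf f0 ss s0 sk vxi _ _ k0 einT Uy).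
    by move=> t It x Sx; have [] := eqs i t x It Sx.
  by move=> t It x Sx; have [] := eqs i t x It Sx.
split=> [ds|kz fz|eh cz].
- have -> : lift_time h = add_vfield (lift_time h)
      (lift_space (I := I) (fun (_ : A) _ => 0)).
    by apply/funext => i; apply/funext => y; rewrite /add_vfield /lift_space row_mx0 addr0.
  apply: main; [exact: sh|exact: vector_field0|move=> i t x It Sx].
  have [-> ->] := ds t It.
  (* The factor 2 h sigma' / sigma vanishes here through sigma' = 0, h being an arbitrary constant;
     in the second part it vanishes because the time component is 0. *)
  by rewrite /vf_apply derive0 lie_derivative0 !mulr0 mul0r oppr0 scale0r addr0.
- have -> : lift_space zeta = add_vfield (lift_time (I := I) (fun=> 0))
      (lift_space zeta).
    apply/funext => i; apply/funext => y; rewrite /add_vfield /lift_time.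
    by rewrite (_ : const_mx 0 = 0) ?row_mx0 ?add0r //; apply/matrixP => a b; rewrite !mxE.
  apply: main => //; first exact: smooth_cst.
  move=> i t x It Sx; rewrite derive1_cst fz // kz //.
  by rewrite !mulr0 !mul0r oppr0 scale0r addr0.
apply: main => // i t x It Sx; split; last exact: cz.
(* Since zeta(ln f) = zeta(f) / f, multiplying by f turns the hypothesis into f h' + zeta(f) = 0. *)
rewrite (eh t It i x Sx) /vf_apply.
rewrite (derive_ln (F := f \o cinv i)) //; last exact: f0.
  by rewrite mulrN /= mulVKf ?gt_eqF ?f0 // addNr.
exact: smooth_derivable (sf i) Sx.
Qed.
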